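(* Let $A\in\mathbb R^{n\times n}$, $B\in\mathbb R^{n\times p}$, $\sigma_w>0$, $\delta\in(0,1)$. Assume we have $N$ independent samples $(y^{(\ell)},x^{(\ell)},u^{(\ell)})$, $\ell=1,\dots,N$, such that $$y^{(\ell)}=Ax^{(\ell)}+Bu^{(\ell)}+w^{(\ell)},$$ where the $w^{(\ell)}$ are i.i.d. $\mathcal N(0,\sigma_w^2I_n)$ and are independent from the $x^{(\ell)}\in\mathbb R^n$ and $u^{(\ell)}\in\mathbb R^p$. Assume $N\ge n+p$. Let $(\widehat A,\widehat B)$ be the ordinary least squares estimator, i.e. a minimizer of $\sum_{\ell=1}^N\|A'x^{(\ell)}+B'u^{(\ell)}-y^{(\ell)}\|_2^2$ over $(A',B')$. Then, with probability at least $1-\delta$, $$\begin{bmatrix} (\widehat A-A)^\top \\ (\widehat B-B)^\top \end{bmatrix}\begin{bmatrix} (\widehat A-A) & (\widehat B-B) \end{bmatrix}\preceq C(n,p,\delta)\left(\sum_{\ell=1}^N\begin{bmatrix} x^{(\ell)} \\ {u}^{(\ell)} \end{bmatrix}\begin{bmatrix} (x^{(\ell)})^\top & (u^{(\ell)})^\top \end{bmatrix}\right)^{-1},$$ where $C(n,p,\delta)=\sigma_w^2\big(\sqrt{n+p}+\sqrt n+\sqrt{2\log(1/\delta)}\big)^2$. If the matrix being inverted on the right-hand side has zero as an eigenvalue, the inverse of that eigenvalue is defined to be infinity.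
   Context: $\preceq$ is the Loewner (positive semidefinite) order. The convention for a singular matrix $M=\sum_\ell z_\ell z_\ell^\top$ with $z_\ell^\top=[(x^{(\ell)})^\top\ (u^{(\ell)})^\top]$ means: the quadratic form $v^\top M^{-1}v$ is $+\infty$ for $v\notin\operatorname{range}(M)$ and equals $v^\top M^{\dagger}v$ for $v\in\operatorname{range}(M)$, and $X\preceq cM^{-1}$ means $v^\top Xv\le c\,v^\top M^{-1}v$ for all $v$. *)

(* Defs.v *)
From HB Require Import structures.
From mathcomp Require Import all_boot all_order all_algebra.
From mathcomp Require Import all_classical all_reals all_analysis.

Set Implicit Arguments.
Unset Strict Implicit.
Unset Printing Implicit Defensive.

Import Order.TTheory GRing.Theory Num.Theory.
Import numFieldTopology.Exports numFieldNormedType.Exports.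

Local Open Scope classical_set_scope.
Local Open Scope ring_scope.

Section Probability.
Context (d : measure_display) (T : measurableType d) (R : realType).
Variable P : probability T R.

Definition borel (U : topologicalType) : set (set U) := <<s [set A | open A] >>.

Definition random_element (U : topologicalType) (X : T -> U) : Prop :=
  forall A, borel A -> measurable (X @^-1` A).

Definition mutually_independent (I : finType) (U : topologicalType)
    (X : I -> T -> U) : Prop :=
  forall (J : {set I}) (A : I -> set U), (forall i, i \in J -> borel (A i)) ->
    P (\bigcap_(i in [set` J]) (X i @^-1` A i)) =
    (\prod_(i in J) P (X i @^-1` A i))%E.

Definition independent_pair (U V : topologicalType) (X : T -> U) (Y : T -> V)
    : Prop :=
  forall A B, borel A -> borel B ->
    P (X @^-1` A `&` Y @^-1` B) = (P (X @^-1` A) * P (Y @^-1` B))%E.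

(* [normal_prob 0 s] has standard deviation [s] (variance [s ^+ 2]). *)
Definition normal_rv (s : R) (X : T -> R) : Prop :=
  forall A, borel A -> P (X @^-1` A) = normal_prob 0 s A.

(* The law N(0, s^2 I_n), i.e. the n-fold product of N(0, s^2). *)
Definition isotropic_gaussian (n : nat) (s : R) (X : T -> 'cV[R]_n) : Prop :=
  (forall i, normal_rv s (fun t => X t i 0)) /\
  mutually_independent (fun (i : 'I_n) (t : T) => X t i 0).

(* The whole family X_1, ..., X_N as a single random element of R^(n x N). *)
Definition family_mx (n N : nat) (X : 'I_N -> T -> 'cV[R]_n) (t : T)
    : 'M[R]_(n, N) :=
  \matrix_(i, l) X l t i 0.

Definition holds_with_prob_ge (q : R) (E : set T) : Prop :=
  measurable E /\ (q%:E <= P E)%E.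

End Probability.

Section LinearAlgebra.
Context (R : realType).

Definition sqnorm2 (n : nat) (v : 'cV[R]_n) : R := \sum_(i < n) v i 0 ^+ 2.

Definition quad_form (n : nat) (X : 'M[R]_n) (v : 'cV[R]_n) : R :=
  (v^T *m X *m v) 0 0.

Definition is_pseudoinverse (m n : nat) (M : 'M[R]_(m, n)) (X : 'M[R]_(n, m))
    : Prop :=
  [/\ M *m X *m M = M, X *m M *m X = X,
      (M *m X)^T = M *m X & (X *m M)^T = X *m M].

Definition pseudoinverse (m n : nat) (M : 'M[R]_(m, n)) : 'M[R]_(n, m) :=
  xget 0 [set X | is_pseudoinverse M X].

Lemma row_free_gram_unit (r n : nat) (F : 'M[R]_(r, n)) :
  row_free F -> F *m F^T \in unitmx.
Proof.
move=> freeF; rewrite -row_free_unit -kermx_eq0; apply/rowV0P => u.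
move=> /sub_kermxP; rewrite mulmxA => uFF.
have uF0 : u *m F = 0.
  have /(congr1 (fun K : 'M[R]_(1, 1) => K 0 0)) : (u *m F) *m (u *m F)^T = 0.
    by rewrite trmx_mul mulmxA uFF mul0mx.
  rewrite !mxE => /eqP; rewrite psumr_eq0; last first.
    by move=> i _; rewrite [X in _ * X]mxE -expr2 sqr_ge0.
  move=> /allP s0; apply/rowP => i; rewrite [RHS]mxE; apply/eqP.
  have := s0 i (mem_index_enum _).
  by rewrite [X in _ * X]mxE -expr2 sqrf_eq0.
by apply: (row_free_inj freeF); rewrite uF0 mul0mx.
Qed.

Lemma full_rank_is_pseudoinverse (m r n : nat) (C : 'M[R]_(m, r))
    (F : 'M[R]_(r, n)) :
  row_free C^T -> row_free F ->
  is_pseudoinverse (C *m F)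
    (F^T *m invmx (F *m F^T) *m (invmx (C^T *m C) *m C^T)).
Proof.
move=> freeC freeF.
have uF : F *m F^T \in unitmx by exact: row_free_gram_unit.
have uC : C^T *m C \in unitmx.
  by rewrite -{2}(trmxK C); exact: row_free_gram_unit.
have symF : (F *m F^T)^T = F *m F^T by rewrite trmx_mul trmxK.
have symC : (C^T *m C)^T = C^T *m C by rewrite trmx_mul trmxK.
set GF := invmx (F *m F^T); set GC := invmx (C^T *m C).
have FG : F *m (F^T *m GF) = 1%:M by rewrite mulmxA mulmxV.
have GCC : GC *m C^T *m C = 1%:M by rewrite -mulmxA mulVmx.
have MX : C *m F *m (F^T *m GF *m (GC *m C^T)) = C *m GC *m C^T.
  by rewrite -mulmxA (mulmxA F) FG mul1mx mulmxA.
have XM : F^T *m GF *m (GC *m C^T) *m (C *m F) = F^T *m GF *m F.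
  by rewrite -mulmxA (mulmxA (GC *m C^T)) GCC mul1mx.
split.
- by rewrite MX mulmxA -(mulmxA C) -(mulmxA C) GCC mulmx1.
- by rewrite XM -(mulmxA _ F) (mulmxA F) FG mul1mx.
- by rewrite MX !trmx_mul trmxK trmx_inv symC mulmxA.
- by rewrite XM !trmx_mul trmxK trmx_inv symF mulmxA.
Qed.

Lemma pseudoinverseP (m n : nat) (M : 'M[R]_(m, n)) :
  is_pseudoinverse M (pseudoinverse M).
Proof.
have exM : exists X, is_pseudoinverse M X.
  eexists; rewrite -{1}(mulmx_base M); apply: full_rank_is_pseudoinverse.
    by rewrite /row_free mxrank_tr; exact: col_base_full.
  exact: row_base_free.
by have := xgetPex 0 exM.
Qed.

Definition inv_quad_form (n : nat) (M : 'M[R]_n) (v : 'cV[R]_n) : \bar R :=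
  if `[< exists a : 'cV[R]_n, v = M *m a >]
  then (quad_form (pseudoinverse M) v)%:E else +oo%E.

Definition loewner_le_scaled_inv (n : nat) (X : 'M[R]_n) (c : R) (M : 'M[R]_n)
    : Prop :=
  forall v : 'cV[R]_n, ((quad_form X v)%:E <= c%:E * inv_quad_form M v)%E.

Definition is_least_squares (n p N : nat) (x : 'I_N -> 'cV[R]_n)
    (u : 'I_N -> 'cV[R]_p) (y : 'I_N -> 'cV[R]_n)
    (Ahat : 'M[R]_n) (Bhat : 'M[R]_(n, p)) : Prop :=
  forall (A' : 'M[R]_n) (B' : 'M[R]_(n, p)),
    \sum_(l < N) sqnorm2 (Ahat *m x l + Bhat *m u l - y l) <=
    \sum_(l < N) sqnorm2 (A' *m x l + B' *m u l - y l).

End LinearAlgebra.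

(* Main.v *)
Require Import Defs.
From HB Require Import structures.
From mathcomp Require Import all_boot all_order all_algebra.
From mathcomp Require Import all_classical all_reals all_analysis.
From mathcomp Require Import measurable_realfun ring lra.
Import Order.TTheory GRing.Theory Num.Theory.
Import numFieldTopology.Exports numFieldNormedType.Exports.

Set Implicit Arguments.
Unset Strict Implicit.
Unset Printing Implicit Defensive.

Local Open Scope classical_set_scope.
Local Open Scope ring_scope.

(* On the range of Z Z^T, where the columns of Z are the (x, u), the normal
   equations read (Theta^ - Theta) Z Z^T = W Z^T, so the event says
   |W Z^T a| <= kappa |Z^T a| for all a.  Since W is independent of Z, it is
   enough to bound, for a fixed Z, the supremum of u^T W q over unit vectors u
   and unit vectors q in the (n + p)-dimensional row space of Z.

   The sharp tail exp(-tau^2 / 2) comes without any Gaussian concentration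
   theorem from a comparison of moment generating functions (Slepian, Kahane,
   Chevet): adding to u^T W q an independent scalar noise g yields a process
   dominated by <h, u> + <h', b>, where b is the image of q under an isometry
   onto R^(n + p), obtained from a Cholesky factor of Z Z^T.  The factor
   E exp(lambda g) = exp(lambda^2 / 2) is then divided out exactly, and
   E exp(lambda |h|) <= exp(lambda sqrt n + lambda^2 / 2) by AM-GM and the
   explicit chi-square moment generating function.

   The comparison is proved for the soft maximum (sum_k exp(beta x_k))^theta
   with beta theta = lambda, and theta -> 0 recovers the maximum.  Gaussian
   averages are convolution operators, one per noise direction; they commute and
   form semigroups in the variance, so the noise can be cut into small
   steps, on each of which a second-order expansion suffices. *)

(** * One-dimensional Gaussian integrals *)

Lemma exchange_integral {d1 d2} {T1 : measurableType d1} {T2 : measurableType d2}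
    {R : realType} (m1 : {sigma_finite_measure set T1 -> \bar R})
    (m2 : {sigma_finite_measure set T2 -> \bar R}) (f : T1 -> T2 -> \bar R) :
  measurable_fun setT (fun z : T1 * T2 => f z.1 z.2) ->
  (forall x y, 0 <= f x y)%E ->
  (\int[m1]_x \int[m2]_y f x y = \int[m2]_y \int[m1]_x f x y)%E.
Proof.
move=> mf f0; exact: (fubini_tonelli (fun z : T1 * T2 => f z.1 z.2) mf (fun z => f0 z.1 z.2)).
Qed.

Section Gaussian1D.
Context {R : realType}.
Notation mu := (@lebesgue_measure R).

(** The Radon-Nikodym derivative of the Gaussian law and [normal_pdf] have equal integrals over
    every measurable set, so they agree almost everywhere. *)
Lemma ge0_integral_normal_prob (m s : R) (f : R -> \bar R) :
  measurable_fun setT f -> (forall x, 0 <= f x)%E ->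
  (\int[normal_prob m s]_x f x = \int[mu]_x (f x * (normal_pdf m s x)%:E))%E.
Proof.
move=> mf f0.
have dom := @normal_prob_dominates R m s.
rewrite -(Radon_Nikodym_SigmaFinite.change_of_variables dom)//.
apply: ae_eq_integral => //.
- apply: emeasurable_funM => //; apply: (measurable_int mu).
  exact: Radon_Nikodym_SigmaFinite.f_integrable.
- apply: emeasurable_funM => //; apply/measurable_EFinP.
  exact: measurable_normal_pdf.
- apply: ae_eqe_mul2l => /=; apply: integral_ae_eq => //.
  + exact: Radon_Nikodym_SigmaFinite.f_integrable.
  + by apply/measurable_EFinP; exact: measurable_normal_pdf.
  + by move=> E _ mE; rewrite -Radon_Nikodym_SigmaFinite.f_integral.
Qed.

Lemma ge0_integral_shift (a : R) (f : R -> \bar R) :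
  measurable_fun setT f -> (forall x, 0 <= f x)%E ->
  (\int[mu]_x f (x + a)%R = \int[mu]_x f x)%E.
Proof.
move=> mf f0.
have msh : measurable_fun setT (fun x : measurableTypeR R => x + a : measurableTypeR R).
  by apply: measurable_funD.
have -> : (\int[mu]_x f (x + a)%R =
    \int[pushforward mu (fun x : measurableTypeR R => (x + a)%R : measurableTypeR R)]_x f x)%E.
  by rewrite ge0_integral_pushforward.
apply: eq_measure_integral => A mA _; apply/esym/lebesgue_measure_unique => //= _ [[b c]] _ <-.
rewrite /pushforward.
have -> : (fun x : R => x + a) @^-1` [set` `]b, c]] = [set` `](b - a), (c - a)]].
  by apply/seteqP; split => x /=; rewrite !in_itv/= ltrBlDr lerBrDr.
rewrite !lebesgue_measure_itv/= !lte_fin ltrD2r; case: ifP => // _.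
by rewrite -!EFinD; congr EFin; ring.
Qed.

Lemma expR_normal_pdf (s c x : R) : s != 0 ->
  expR (c * x) * normal_pdf 0 s x =
  expR (s ^+ 2 * c ^+ 2 / 2) * normal_pdf (s ^+ 2 * c) s x.
Proof.
move=> s0; rewrite !normal_pdfE// /normal_fun.
rewrite mulrCA [RHS]mulrCA; congr (_ * _).
by rewrite -!expRD; congr expR; field.
Qed.

Lemma integral_normal_expR (s c d : R) : s != 0 ->
  (\int[normal_prob 0 s]_r (expR (c * r + d))%:E =
   (expR (d + s ^+ 2 * c ^+ 2 / 2))%:E)%E.
Proof.
move=> s0; rewrite ge0_integral_normal_prob//; last first.
  apply/measurable_EFinP; apply: measurableT_comp => //.
  by apply: measurable_funD => //; apply: measurable_funM.
under eq_integral => x _.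
  rewrite -EFinM expRD mulrAC expR_normal_pdf// mulrAC -expRD EFinM; over.
rewrite ge0_integralZl//.
- by rewrite integral_normal_pdf mule1 addrC.
- by apply/measurable_EFinP; exact: measurable_normal_pdf.
- by move=> x _; rewrite lee_fin normal_pdf_ge0.
Qed.

(** A quadratic exponential tilt of a centred Gaussian is again a centred Gaussian, up to the factor
    [q^-1]; integrating gives the chi-square moment generating function. *)
Lemma expR_sqr_normal_pdf (s q x : R) : 0 < s -> 0 < q ->
  expR ((1 - q ^+ 2) * x ^+ 2 / (2 * s ^+ 2)) * normal_pdf 0 s x =
  q^-1 * normal_pdf 0 (s / q) x.
Proof.
move=> s0 q0.
have sn : s != 0 by rewrite gt_eqF.
have qn : q != 0 by rewrite gt_eqF.
have sqn : s / q != 0 by rewrite mulf_neq0// invr_eq0.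
rewrite !normal_pdfE// /normal_fun mulrCA -expRD [RHS]mulrA; congr (_ * expR _).
  rewrite /normal_peak.
  have -> : (s / q) ^+ 2 * pi *+ 2 = s ^+ 2 * pi *+ 2 * (q^-1) ^+ 2.
    by rewrite expr_div_n exprVn -!mulrnAr mulrAC.
  rewrite sqrtrM ?mulrn_wge0 ?(mulr_ge0 (sqr_ge0 _) (pi_ge0 _))//.
  by rewrite sqrtr_sqr gtr0_norm ?invr_gt0// invfM invrK mulrCA mulVf// mulr1.
by rewrite subr0; field; rewrite sn qn.
Qed.

Lemma integral_normal_expR_sqr (s al : R) : 0 < s -> al < 1 ->
  (\int[normal_prob 0 s]_r (expR (al * r ^+ 2 / (2 * s ^+ 2)))%:E =
   ((Num.sqrt (1 - al))^-1)%:E)%E.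
Proof.
move=> s0 al1; rewrite ge0_integral_normal_prob//; last first.
  apply/measurable_EFinP; apply: measurableT_comp => //.
  apply: measurable_funM => //; apply: measurable_funM => //.
have q0 : 0 < Num.sqrt (1 - al) by rewrite sqrtr_gt0 subr_gt0.
have alE : al = 1 - Num.sqrt (1 - al) ^+ 2.
  by rewrite sqr_sqrtr ?subKr// subr_ge0 ltW.
under eq_integral => x _.
  rewrite -EFinM [in expR _]alE expR_sqr_normal_pdf// EFinM; over.
rewrite ge0_integralZl//.
- by rewrite integral_normal_pdf mule1.
- by apply/measurable_EFinP; exact: measurable_normal_pdf.
- by move=> x _; rewrite lee_fin normal_pdf_ge0.
Qed.

(** The joint density of two independent Gaussians, factored as the density of their sum at [x]
    times the conditional density of the second summand given that sum. *)
Lemma normal_pdf_conv (s t x y : R) : 0 < s -> 0 < t ->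
  normal_pdf 0 s (x - y) * normal_pdf 0 t y =
  normal_pdf 0 (Num.sqrt (s ^+ 2 + t ^+ 2)) x *
  normal_pdf (x * t ^+ 2 / (s ^+ 2 + t ^+ 2))
             (s * t / Num.sqrt (s ^+ 2 + t ^+ 2)) y.
Proof.
move=> s0 t0; set q := Num.sqrt _.
have st0 : 0 < s ^+ 2 + t ^+ 2 by rewrite addr_gt0// exprn_gt0.
have q0 : 0 < q by rewrite sqrtr_gt0.
have q2 : q ^+ 2 = s ^+ 2 + t ^+ 2 by rewrite sqr_sqrtr// ltW.
clearbody q.
have sn : s != 0 by rewrite gt_eqF.
have tn : t != 0 by rewrite gt_eqF.
have qn : q != 0 by rewrite gt_eqF.
have p0 : 0 <= pi *+ 2 :> R by rewrite mulrn_wge0 ?pi_ge0.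
have pk (z : R) : 0 < z -> normal_peak z = z^-1 * (Num.sqrt (pi *+ 2))^-1.
  move=> z0; rewrite /normal_peak -mulrnAr sqrtrM ?sqr_ge0// sqrtr_sqr gtr0_norm//.
  by rewrite invfM.
rewrite !normal_pdfE ?gt_eqF ?divr_gt0 ?mulr_gt0// !pk ?divr_gt0 ?mulr_gt0//.
rewrite /normal_fun mulrACA [RHS]mulrACA -!expRD; congr (_ * expR _).
  rewrite !invfM invrK mulrACA [RHS]mulrACA; congr (_ * _).
  by field; rewrite sn tn qn.
rewrite !expr_div_n q2 ?exprMn.
by field; rewrite sn tn gt_eqF.
Qed.

Lemma normal_prob_conv (s t : R) (F : R -> \bar R) : 0 < s -> 0 < t ->
  measurable_fun setT F -> (forall x, 0 <= F x)%E ->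
  (\int[normal_prob 0 s]_r \int[normal_prob 0 t]_y F (r + y)%R =
   \int[normal_prob 0 (Num.sqrt (s ^+ 2 + t ^+ 2))]_r F r)%E.
Proof.
move=> s0 t0 mF F0.
have mD : measurable_fun setT (fun z : R * R => F (z.1 + z.2)%R).
  by apply: measurableT_comp => //; exact: measurable_funD.
have mDx x : measurable_fun setT (fun y : R => F (x + y)).
  by apply: measurableT_comp => //; exact: measurable_funD.
have mp (m z : R) := @measurable_normal_pdf R m z.
rewrite ge0_integral_normal_prob//; last 2 first.
- by apply: (measurable_fun_fubini_tonelli_F (m2 := normal_prob 0 t)
    (fun z : R * R => F (z.1 + z.2)%R)).
- by move=> x; apply: integral_ge0.
transitivity (\int[mu]_x \int[mu]_y
   (F (x + y)%R * (normal_pdf 0 t y)%:E * (normal_pdf 0 s x)%:E))%E.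
  apply: eq_integral => x _; rewrite ge0_integral_normal_prob//.
  rewrite ge0_integralZr//.
  - by apply: emeasurable_funM; [exact: mDx|by apply/measurable_EFinP; exact: mp].
  - by move=> y _; rewrite mule_ge0// lee_fin normal_pdf_ge0.
  - by rewrite lee_fin normal_pdf_ge0.
pose h (z : R * R) := (F (z.1 + z.2)%R * (normal_pdf 0 t z.2)%:E *
  (normal_pdf 0 s z.1)%:E)%E.
have mh : measurable_fun setT h.
  apply: emeasurable_funM; first apply: emeasurable_funM => //.
  - by apply/measurable_EFinP; exact: (measurableT_comp (mp _ _)).
  - by apply/measurable_EFinP; exact: (measurableT_comp (mp _ _)).
have h0 z : (0 <= h z)%E by rewrite !mule_ge0// lee_fin normal_pdf_ge0.
transitivity (\int[mu]_y \int[mu]_x h (x, y))%E; first exact: fubini_tonelli.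
transitivity (\int[mu]_y \int[mu]_x
   (F x * (normal_pdf 0 t y)%:E * (normal_pdf 0 s (x - y))%:E))%E.
  apply: eq_integral => y _.
  rewrite -(@ge0_integral_shift (- y) (fun x => h (x, y))).
  - by apply: eq_integral => x _; rewrite /h/= subrK.
  - exact: (measurableT_comp mh).
  - by move=> x.
pose k (z : R * R) := (F z.2 * (normal_pdf 0 t z.1)%:E *
  (normal_pdf 0 s (z.2 - z.1))%:E)%E.
have mk : measurable_fun setT k.
  apply: emeasurable_funM; first apply: emeasurable_funM => //.
  - exact: (measurableT_comp mF).
  - by apply/measurable_EFinP; exact: (measurableT_comp (mp _ _)).
  - apply/measurable_EFinP; apply: (measurableT_comp (mp _ _)).
    exact: measurable_funB.
have k0 z : (0 <= k z)%E by rewrite !mule_ge0// lee_fin normal_pdf_ge0.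
transitivity (\int[mu]_x \int[mu]_y k (y, x))%E.
  exact: (exchange_integral mu mu (f := fun y x => k (y, x))).
rewrite ge0_integral_normal_prob//; apply: eq_integral => x _; rewrite /k/=.
under eq_integral => y _.
  rewrite -muleA -EFinM (mulrC (normal_pdf 0 t y)) normal_pdf_conv// EFinM muleA; over.
rewrite ge0_integralZl//.
- by rewrite integral_normal_pdf mule1.
- apply/measurable_EFinP; exact: mp.
- by move=> y _; rewrite lee_fin normal_pdf_ge0.
- by rewrite mule_ge0// lee_fin normal_pdf_ge0.
Qed.

End Gaussian1D.

(** * Gaussian smoothing operators *)

Section GaussianSmoothing.
Context {R : realType} {K : finType}.

(** The product sigma-algebra on [K -> R]: measurability into it can be checked one coordinate at a
    time. *)
Definition pspace := g_sigma_algebraType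
  [set A : set (K -> R) | exists k (B : set R), measurable B /\ A = (fun x => x k) @^-1` B].

Lemma measurable_coord (k : K) : measurable_fun setT (fun x : pspace => x k).
Proof.
move=> _ B mB; rewrite setTI; apply: sub_sigma_algebra.
by exists k, B.
Qed.

Lemma measurable_pspace {d} {T : measurableType d} (f : T -> pspace) :
  (forall k, measurable_fun setT (fun t => f t k)) -> measurable_fun setT f.
Proof.
move=> mf; apply: measurability => //= _ [_ [k [B [mB ->]]] <-].
exact: mf.
Qed.

(** Nonnegative extended-real integrands make Tonelli applicable with no integrability condition. *)
Definition admissible (F : pspace -> \bar R) :=
  measurable_fun setT F /\ forall x, (0 <= F x)%E.

Definition dot (c v : K -> R) : R := \sum_k c k * v k.

Definition gsmooth (s : R) (v : K -> R) (F : pspace -> \bar R) (x : pspace) : \bar R :=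
  (\int[normal_prob 0 s]_r F (fun k => x k + r * v k)%R)%E.

(** The mean of [F] at [x] plus a centred Gaussian vector whose covariance is [s ^+ 2] times the sum
    of v v^T over the directions v in [l]. *)
Definition gsmooths (s : R) (l : seq (K -> R)) (F : pspace -> \bar R) :
  pspace -> \bar R := foldr (gsmooth s) F l.

Lemma measurable_move {d} {T : measurableType d} (f : T -> pspace) (g : T -> R)
    (v : K -> R) : measurable_fun setT f -> measurable_fun setT g ->
  measurable_fun setT (fun t => (fun k => f t k + g t * v k) : pspace).
Proof.
move=> mf mg; apply: measurable_pspace => k; apply: measurable_funD.
  exact: (measurableT_comp (measurable_coord k) mf).
exact: measurable_funM.
Qed.

Lemma measurable_section (v : K -> R) (x : pspace) (F : pspace -> \bar R) :
  measurable_fun setT F ->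
  measurable_fun setT (fun r : R => F (fun k => x k + r * v k)).
Proof.
move=> mF; apply: (measurableT_comp mF).
exact: (measurable_move (f := fun=> x) (g := id)).
Qed.

Lemma admissible_gsmooth s v F : admissible F -> admissible (gsmooth s v F).
Proof.
move=> [mF F0]; split; last by move=> x; exact: integral_ge0.
apply: (measurable_fun_fubini_tonelli_F (m2 := normal_prob 0 s)
  (fun z : pspace * R => F (fun k => z.1 k + z.2 * v k))) => //.
by apply: (measurableT_comp mF); exact: measurable_move.
Qed.

Lemma admissible_gsmooths s l F : admissible F -> admissible (gsmooths s l F).
Proof. by move=> aF; elim: l => //= v l ih; exact: admissible_gsmooth. Qed.

Lemma admissibleM F G : admissible F -> admissible G -> admissible (F \* G)%E.
Proof.
move=> [mF F0] [mG G0]; split; first exact: emeasurable_funM.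
by move=> x; rewrite mule_ge0.
Qed.

Lemma admissible_cst (c : \bar R) : (0 <= c)%E -> admissible (fun=> c).
Proof. by move=> c0; split. Qed.

Lemma measurable_dot (c : K -> R) : measurable_fun setT (dot c : pspace -> R).
Proof.
apply: measurable_sum => k; apply: measurable_funM => //.
exact: measurable_coord.
Qed.

Lemma gsmooth_comm s t v w F : admissible F ->
  gsmooth s v (gsmooth t w F) = gsmooth t w (gsmooth s v F).
Proof.
move=> [mF F0]; apply/funext => x.
rewrite /gsmooth (exchange_integral (normal_prob 0 s) (normal_prob 0 t)
  (f := fun r q => F (fun k => x k + r * v k + q * w k))) => //; last first.
  apply: (measurableT_comp mF); apply: measurable_move => //.
  exact: (measurable_move (f := fun=> x)).
apply: eq_integral => q _; apply: eq_integral => r _; congr F.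
by apply/funext => k; rewrite addrAC.
Qed.

Lemma gsmooth_conv s t v F : 0 < s -> 0 < t -> admissible F ->
  gsmooth s v (gsmooth t v F) = gsmooth (Num.sqrt (s ^+ 2 + t ^+ 2)) v F.
Proof.
move=> s0 t0 [mF F0]; apply/funext => x.
rewrite /gsmooth -(normal_prob_conv (F := fun r => F (fun k => x k + r * v k)))//;
  last exact: measurable_section.
apply: eq_integral => r _; apply: eq_integral => q _; congr F.
by apply/funext => k; rewrite mulrDl addrA.
Qed.

Lemma gsmooth_gsmooths s t v l F : admissible F ->
  gsmooth s v (gsmooths t l F) = gsmooths t l (gsmooth s v F).
Proof.
move=> aF; elim: l => [//|w l ih].
by rewrite /= gsmooth_comm ?ih//; exact: admissible_gsmooths.
Qed.

Lemma gsmooths_comm s t l l' F : admissible F ->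
  gsmooths s l (gsmooths t l' F) = gsmooths t l' (gsmooths s l F).
Proof.
move=> aF; elim: l => [//|v l ih].
by rewrite /= ih gsmooth_gsmooths//; exact: admissible_gsmooths.
Qed.

Lemma gsmooths_conv s t l F : 0 < s -> 0 < t -> admissible F ->
  gsmooths s l (gsmooths t l F) = gsmooths (Num.sqrt (s ^+ 2 + t ^+ 2)) l F.
Proof.
move=> s0 t0 aF; elim: l => [//|v l ih].
(* Commuting the operators brings the two noises along [v] next to each other, where [gsmooth_conv]
   merges them. *)
rewrite /= -(gsmooth_gsmooths t s v l (admissible_gsmooths t l aF)).
rewrite ih.
rewrite (gsmooth_conv v s0 t0 (admissible_gsmooths (Num.sqrt (s ^+ 2 + t ^+ 2)) l aF)).
by [].
Qed.

Lemma le_gsmooth s v F G : admissible F -> admissible G ->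
  (forall x, F x <= G x)%E -> forall x, (gsmooth s v F x <= gsmooth s v G x)%E.
Proof.
move=> [mF F0] [mG G0] FG x; apply: ge0_le_integral => //;
  exact: measurable_section.
Qed.

Lemma le_gsmooths s l F G : admissible F -> admissible G ->
  (forall x, F x <= G x)%E -> forall x, (gsmooths s l F x <= gsmooths s l G x)%E.
Proof.
move=> aF aG FG; elim: l => //= v l ih.
by apply: le_gsmooth => //; exact: admissible_gsmooths.
Qed.

Lemma gsmoothZ s v c F : (0 <= c)%E -> admissible F ->
  gsmooth s v (fun x => c * F x)%E = (fun x => c * gsmooth s v F x)%E.
Proof.
move=> c0 [mF F0]; apply/funext => x; rewrite /gsmooth ge0_integralZl//.
exact: measurable_section.
Qed.

Lemma gsmoothsZ s l c F : (0 <= c)%E -> admissible F ->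
  gsmooths s l (fun x => c * F x)%E = (fun x => c * gsmooths s l F x)%E.
Proof.
move=> c0 aF; elim: l => //= v l ->; rewrite gsmoothZ//.
exact: admissible_gsmooths.
Qed.

Lemma gsmoothD s v F G : admissible F -> admissible G ->
  gsmooth s v (F \+ G)%E = (gsmooth s v F \+ gsmooth s v G)%E.
Proof.
move=> [mF F0] [mG G0]; apply/funext => x; rewrite /gsmooth ge0_integralD//;
  exact: measurable_section.
Qed.

Lemma gsmoothsD s l F G : admissible F -> admissible G ->
  gsmooths s l (F \+ G)%E = (gsmooths s l F \+ gsmooths s l G)%E.
Proof.
move=> aF aG; elim: l => //= v l ->; rewrite gsmoothD//;
  exact: admissible_gsmooths.
Qed.

Lemma gsmooths_cst s l (c : R) : 0 <= c ->
  gsmooths s l (fun=> c%:E) = (fun=> c%:E).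
Proof.
move=> c0; elim: l => //= v l ->; apply/funext => x.
rewrite /gsmooth integral_cst//.
by rewrite [X in (_ * X)%E]probability_setT mule1.
Qed.

Lemma admissible_sum (I : Type) (r : seq I) (F : I -> pspace -> \bar R) :
  (forall i, admissible (F i)) -> admissible (fun x => \sum_(i <- r) F i x)%E.
Proof.
move=> aF; split; last by move=> x; apply: sume_ge0 => i _; case: (aF i).
by apply: emeasurable_sum => i; case: (aF i).
Qed.

Lemma gsmooths_sum s l (I : Type) (r : seq I) (F : I -> pspace -> \bar R) :
  (forall i, admissible (F i)) ->
  gsmooths s l (fun x => \sum_(i <- r) F i x)%E =
  (fun x => \sum_(i <- r) gsmooths s l (F i) x)%E.
Proof.
move=> aF; elim: r => [|i r ih].
  under eq_fun do rewrite big_nil.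
  by rewrite gsmooths_cst//; apply/funext => x; rewrite big_nil.
under eq_fun do rewrite big_cons.
have := @gsmoothsD s l (F i) (fun x => \sum_(i <- r) F i x)%E (aF i) (admissible_sum r aF).
by move=> ->; rewrite ih; apply/funext => x; rewrite big_cons.
Qed.

Lemma admissible_expR (c : K -> R) d : admissible (fun y => (expR (dot c y + d))%:E).
Proof.
split; last by move=> x; rewrite lee_fin expR_ge0.
apply/measurable_EFinP; apply: measurableT_comp => //.
by apply: measurable_funD => //; exact: measurable_dot.
Qed.

Lemma gsmooths_expR s l (c : K -> R) d : s != 0 ->
  gsmooths s l (fun y => (expR (dot c y + d))%:E) =
  (fun x => (expR (dot c x + d + s ^+ 2 / 2 * \sum_(v <- l) dot c v ^+ 2))%:E).
Proof.
move=> s0; elim: l => [|v l ih]; first by apply/funext => x; rewrite big_nil mulr0 addr0.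
rewrite /= ih; apply/funext => x; rewrite /gsmooth big_cons.
under eq_integral => r _.
  rewrite (_ : dot c _ = dot c v * r + dot c x); last first.
    rewrite /dot mulr_suml -big_split/=; apply: eq_bigr => k _.
    by rewrite mulrDr addrC mulrA (mulrAC (c k)).
  rewrite -!addrA; over.
rewrite /= integral_normal_expR//; congr (expR _)%:E.
by rewrite mulrDr; ring.
Qed.

End GaussianSmoothing.

(** * Real inequalities *)

Section RealInequalities.
Context {R : realType}.
Implicit Types x z : R.

Lemma powR_expR z a : 0 < z -> z `^ a = expR (a * ln z).
Proof. by move=> z0; rewrite /powR gt_eqF. Qed.

(** Since (1 - x) exp(x) <= 1, it suffices that (1 - x)(1 + x + 2x^2) = 1 + x^2 (1 - 2x) is at least
    1. *)
Lemma expR_ub x : x <= 2^-1 -> expR x <= 1 + x + 2 * x ^+ 2.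
Proof.
move=> x1.
have h : (1 - x) * expR x <= 1.
  rewrite -[leRHS](expRxMexpNx_1 x) mulrC ler_wpM2l ?expR_ge0//.
  exact: expR_ge1Dx.
have h2 : 1 <= (1 - x) * (1 + x + 2 * x ^+ 2).
  by have := sqr_ge0 x; nra.
by have x0 : 0 < 1 - x by [lra]; rewrite -(ler_pM2l x0) (le_trans h).
Qed.

(** Bernoulli's inequality. With L = ln z it is, after division by exp(aL), the average of the
    tangent bounds for exp(-aL) and exp((1 - a)L) with weights 1 - a and a. *)
Lemma powR_le_affine z a : 0 < z -> 0 <= a <= 1 -> z `^ a <= 1 + a * (z - 1).
Proof.
move=> z0 /andP[a0 a1]; rewrite powR_expR//; set L := ln z.
have zE : z = expR L by rewrite lnK ?posrE.
have h1 := expR_ge1Dx (- (a * L)); have h2 := expR_ge1Dx ((1 - a) * L).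
have h3 : 1 <= (1 - a) * expR (- (a * L)) + a * expR ((1 - a) * L).
  have : (1 - a) * (1 + - (a * L)) <= (1 - a) * expR (- (a * L)).
    by rewrite ler_wpM2l// subr_ge0.
  have : a * (1 + (1 - a) * L) <= a * expR ((1 - a) * L) by rewrite ler_wpM2l.
  by lra.
have e1 : expR (a * L) * expR (- (a * L)) = 1 by rewrite -expRD subrr expR0.
have e2 : expR (a * L) * expR ((1 - a) * L) = expR L by rewrite -expRD; congr expR; ring.
have /(ler_wpM2l (expR_ge0 (a * L))) := h3.
rewrite mulr1 mulrDr mulrCA e1 mulrCA e2 [in X in _ -> X]zE.
by move=> /le_trans; apply; lra.
Qed.

Lemma powRN_ge_affine z a : 0 < z -> 0 <= a -> 1 - a * (z - 1) <= z `^ (- a).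
Proof.
move=> z0 a0; rewrite powR_expR//.
have := expR_ge1Dx (- a * ln z); apply: le_trans.
have : ln z <= z - 1.
  by have := expR_ge1Dx (ln z); rewrite lnK ?posrE// => ?; lra.
by nra.
Qed.

Lemma powRN_le_quad z a : 2^-1 <= z -> 0 <= a <= 1 ->
  z `^ (- a) <= 1 - a * (z - 1) + 2 * a * (z - 1) ^+ 2.
Proof.
move=> z2 a01; have z0 : 0 < z by lra.
have -> : z `^ (- a) = z^-1 `^ a.
  by rewrite !powR_expR ?invr_gt0// lnV ?posrE// mulNr mulrN.
have zi : 0 < z^-1 by rewrite invr_gt0.
apply: (le_trans (powR_le_affine zi a01)).
have hz : z^-1 - 1 = - (z - 1) + (z - 1) ^+ 2 * z^-1 by field; rewrite gt_eqF.
rewrite hz.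
have : (z - 1) ^+ 2 * z^-1 <= (z - 1) ^+ 2 * 2.
  by rewrite ler_wpM2l ?sqr_ge0// -[leRHS]invrK lef_pV2 ?posrE.
by move: ((z - 1) ^+ 2 * z^-1) ((z - 1) ^+ 2) => u v; nra.
Qed.

(** Below 1/2 the right side is at least 2 and crude bounds suffice. From 1/2 on, the affine and
    quadratic bounds on y^(a - 1) bound the derivative of the remainder by (y - 1)^2, and the mean
    value theorem supplies the third factor. *)
Lemma powR_taylor2 z a : 0 < z -> 0 <= a <= 1 ->
  `|z `^ a - (1 + a * (z - 1) - a * (1 - a) / 2 * (z - 1) ^+ 2)| <=
  16 * `|z - 1| ^+ 3.
Proof.
move=> z0 /andP[a0 a1]; have [z2|z2] := ltP z 2^-1.
  have p1 : z `^ a <= 1.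
    apply: (le_trans (powR_le_affine z0 _)); first by rewrite a0.
    by nra.
  have p0 := powR_ge0 z a.
  have n3 : 8^-1 <= `|z - 1| ^+ 3.
    rewrite ltr0_norm; last by lra.
    have [u u0 ->] : exists2 u, 0 <= u & - (z - 1) = u + 2^-1.
      by exists (2^-1 - z); [lra|lra].
    rewrite exprS expr2.
    have : 0 <= u * u by exact: mulr_ge0.
    have : 0 <= u * u * u by rewrite !mulr_ge0.
    by nra.
  apply: (@le_trans _ _ 2); last by lra.
  rewrite ler_norml; apply/andP; split.
    have : a * (z - 1) <= 0 by nra.
    have : 0 <= a * (1 - a) / 2 * (z - 1) ^+ 2.
      by apply: mulr_ge0; [nra|exact: sqr_ge0].
    by lra.
  have : - a <= a * (z - 1) by nra.
  have : a * (1 - a) / 2 * (z - 1) ^+ 2 <= 1.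
    have s1 : (z - 1) ^+ 2 <= 1 by rewrite expr2; nra.
    have s0 := sqr_ge0 (z - 1).
    have : a * (1 - a) / 2 <= 1 by nra.
    have : 0 <= a * (1 - a) / 2 by nra.
    move: (a * (1 - a) / 2) ((z - 1) ^+ 2) s0 s1 => u v; nra.
  by lra.
pose g (y : R) := y `^ a - (1 + a * (y - 1) - a * (1 - a) / 2 * (y - 1) ^+ 2).
pose dg (y : R) := a * y `^ (a - 1) - (a - a * (1 - a) * (y - 1)).
have dgE (y : R) : 0 < y -> is_derive y 1 g (dg y).
  move=> y0; rewrite /g /dg.
  have ? := is_derive1_powR a y0.
  apply: is_derive_eq; rewrite /GRing.scale/=; lra.
have dgb (y : R) : 2^-1 <= y -> `|dg y| <= (y - 1) ^+ 2.
  move=> y2; have y0 : 0 < y by lra.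
  have := @powRN_ge_affine y (1 - a) y0; rewrite subr_ge0 opprB => /(_ a1) lo.
  have := @powRN_le_quad y (1 - a) y2; rewrite opprB => hi.
  have {}hi := hi ltac:(by apply/andP; split; lra).
  have s0 := sqr_ge0 (y - 1).
  have a4 : 2 * (a * (1 - a)) <= 1 by have := sqr_ge0 (a - 2^-1); rewrite expr2; nra.
  have d0 : 0 <= dg y.
    have -> : dg y = a * (y `^ (a - 1) - (1 - (1 - a) * (y - 1))) by rewrite /dg; ring.
    by rewrite mulr_ge0// subr_ge0.
  rewrite ger0_norm//.
  apply: (@le_trans _ _ (a * (2 * (1 - a) * (y - 1) ^+ 2))).
    have -> : dg y = a * (y `^ (a - 1) - (1 - (1 - a) * (y - 1))) by rewrite /dg; ring.
    by rewrite ler_wpM2l//; lra.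
  have -> : a * (2 * (1 - a) * (y - 1) ^+ 2) = 2 * (a * (1 - a)) * (y - 1) ^+ 2 by ring.
  by rewrite -[leRHS]mul1r ler_wpM2r.
have g1 : g 1 = 0 by rewrite /g powR1 subrr !mulr0 expr0n/= mulr0; ring.
have key (u v : R) : 2^-1 <= u -> u <= v -> exists2 c, u <= c <= v & g v - g u = dg c * (v - u).
  move=> u2 uv; have [||c] := @MVT_segment _ g dg u v uv.
    move=> y; rewrite in_itv/= => /andP[uy _]; apply: dgE; lra.
    apply: derivable_within_continuous => y; rewrite in_itv/= => /andP[uy _].
    have y0 : 0 < y by lra.
    by have [] := dgE y y0.
  by rewrite in_itv/= => cuv E; exists c.
rewrite -[leLHS]/`|g z|.
suff [c cb E] : exists2 c, 2^-1 <= c /\ (c - 1) ^+ 2 <= (z - 1) ^+ 2 & `|g z| = `|dg c| * `|z - 1|.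
  case: cb => c2 cz; rewrite E.
  have -> : `|z - 1| ^+ 3 = (z - 1) ^+ 2 * `|z - 1|.
    by rewrite exprSr -normrX ger0_norm ?sqr_ge0.
  rewrite mulrA ler_wpM2r//; apply: (le_trans (dgb _ c2)).
  by have := sqr_ge0 (z - 1); lra.
have [z1|z1] := leP 1 z.
  have h1 : 2^-1 <= 1 :> R by lra.
  have [c /andP[c1 c2] E] := key 1 z h1 z1.
  exists c; last by rewrite -normrM -E g1 subr0.
  by split; [lra|rewrite !expr2; nra].
have [c /andP[c1 c2] E] := key z 1 z2 (ltW z1).
exists c; last first.
  have -> : g z = - (dg c * (1 - z)) by rewrite -E g1; ring.
  by rewrite normrN normrM; congr (_ * _); exact: distrC.
by split; [lra|rewrite !expr2; nra].
Qed.

Lemma jensen_sqr (I : finType) (p u : I -> R) : (forall i, 0 <= p i) ->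
  \sum_i p i = 1 -> (\sum_i p i * u i) ^+ 2 <= \sum_i p i * u i ^+ 2.
Proof.
move=> p0 p1.
have E c : \sum_i p i * (u i - c) ^+ 2 =
    \sum_i p i * u i ^+ 2 - 2 * c * (\sum_i p i * u i) + c ^+ 2 * \sum_i p i.
  rewrite !mulr_sumr -sumrB -big_split/=.
  by apply: eq_bigr => i _; ring.
set m := \sum_i p i * u i.
have : 0 <= \sum_i p i * (u i - m) ^+ 2.
  by apply: sumr_ge0 => i _; rewrite mulr_ge0// sqr_ge0.
by rewrite E p1 -/m => ?; rewrite expr2; lra.
Qed.

Lemma jensen_expR (I : finType) (p u : I -> R) : (forall i, 0 <= p i) ->
  \sum_i p i = 1 -> expR (\sum_i p i * u i) <= \sum_i p i * expR (u i).
Proof.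
move=> p0 p1; set m := \sum_i _ * u _.
have E c : \sum_i p i * (expR c * (1 + (u i - c))) =
    expR c * (\sum_i p i * u i + (1 - c) * \sum_i p i).
  by rewrite mulr_sumr -big_split mulr_sumr/=; apply: eq_bigr => i _; ring.
have -> : expR m = \sum_i p i * (expR m * (1 + (u i - m))).
  by rewrite E p1 -/m; ring.
apply: ler_sum => i _; rewrite ler_wpM2l//.
rewrite -[in leRHS](subrK m (u i)) [in leRHS]addrC expRD ler_wpM2l ?expR_ge0//.
exact: expR_ge1Dx.
Qed.

(** AM-GM. When u is of order t, both terms on the right are of order t^3, and unlike the absolute
    cube they are polynomials in u. *)
Lemma cube_le (t u : R) : 0 < t -> `|u| ^+ 3 <= 2^-1 * (t * u ^+ 2 + u ^+ 4 / t).
Proof.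
move=> t0.
have -> : u ^+ 2 = `|u| ^+ 2 by rewrite real_normK// num_real.
have -> : u ^+ 4 = `|u| ^+ 4 by rewrite -normrX ger0_norm// (exprM u 2 2) sqr_ge0.
move: `|u| (normr_ge0 u) => {}u u0.
rewrite -subr_ge0.
have -> : 2^-1 * (t * u ^+ 2 + u ^+ 4 / t) - u ^+ 3 =
   2^-1 * (u ^+ 2 * (t - u) ^+ 2 / t) by field; rewrite gt_eqF.
apply: mulr_ge0; first by rewrite invr_ge0.
by apply: divr_ge0; [apply: mulr_ge0; exact: sqr_ge0|exact: ltW].
Qed.

End RealInequalities.

(** * One comparison step *)

Section SmoothingExpectation.
Context {R : realType} {K : finType}.
Variables (s : R) (l : seq (K -> R)) (x : @pspace R K).
Implicit Types (A B C : @pspace R K -> R) (a b : R).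

(** Packaging the finiteness of a Gaussian mean with its value lets the comparison proceed in real
    arithmetic. *)
Definition has_gmean A a := [/\ (forall y, 0 <= A y), measurable_fun setT A &
  gsmooths s l (EFin \o A) x = a%:E].

Lemma admissible_EFin A : (forall y, 0 <= A y) -> measurable_fun setT A ->
  admissible (EFin \o A).
Proof. by move=> A0 mA; split => //; exact/measurable_EFinP. Qed.

Lemma has_gmean_admissible A a : has_gmean A a -> admissible (EFin \o A).
Proof. by move=> [A0 mA _]; exact: admissible_EFin. Qed.

Lemma has_gmean_cst a : 0 <= a -> has_gmean (fun=> a) a.
Proof. by move=> a0; split => //; rewrite (_ : _ \o _ = fun=> a%:E)// gsmooths_cst. Qed.

Lemma has_gmeanD A a B b : has_gmean A a -> has_gmean B b ->
  has_gmean (fun y => A y + B y) (a + b).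
Proof.
move=> hA hB; have aA := has_gmean_admissible hA; have aB := has_gmean_admissible hB.
case: hA hB => [A0 mA EA] [B0 mB EB]; split.
- by move=> y; rewrite addr_ge0.
- exact: measurable_funD.
- rewrite (_ : _ \o _ = (EFin \o A) \+ (EFin \o B))%E// gsmoothsD//=.
  by rewrite EA EB.
Qed.

Lemma has_gmeanZ c A a : 0 <= c -> has_gmean A a ->
  has_gmean (fun y => c * A y) (c * a).
Proof.
move=> c0 hA; have aA := has_gmean_admissible hA.
case: hA => [A0 mA EA]; split.
- by move=> y; rewrite mulr_ge0.
- exact: measurable_funM.
- rewrite (_ : _ \o _ = fun y => c%:E * (EFin \o A) y)%E// gsmoothsZ ?lee_fin//.
  by rewrite EA.
Qed.

Lemma has_gmean_sum (I : finType) (A : I -> @pspace R K -> R) (a : I -> R) :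
  (forall i, has_gmean (A i) (a i)) ->
  has_gmean (fun y => \sum_i A i y) (\sum_i a i).
Proof.
move=> hA.
have aA i := has_gmean_admissible (hA i).
split.
- by move=> y; apply: sumr_ge0 => i _; case: (hA i).
- by apply: measurable_sum => i; case: (hA i).
- rewrite (_ : _ \o _ = fun y => \sum_i (EFin \o A i) y)%E; last first.
    by apply/funext => y /=; rewrite sumEFin.
  rewrite gsmooths_sum//= -sumEFin; apply: eq_bigr => i _.
  by case: (hA i).
Qed.

Lemma has_gmean_expR (c : K -> R) d : s != 0 ->
  has_gmean (fun y => expR (dot c y + d))
    (expR (dot c x + d + s ^+ 2 / 2 * \sum_(v <- l) dot c v ^+ 2)).
Proof.
move=> s0; have [/measurable_EFinP mA _] := @admissible_expR R K c d.
by split; [move=> y; exact: expR_ge0|exact: mA|rewrite gsmooths_expR].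
Qed.

Lemma has_gmean_le A a B b : has_gmean A a -> has_gmean B b ->
  (forall y, A y <= B y) -> a <= b.
Proof.
move=> hA hB AB; have aA := has_gmean_admissible hA; have aB := has_gmean_admissible hB.
case: hA hB => [_ _ EA] [_ _ EB]; rewrite -lee_fin -EA -EB.
by apply: le_gsmooths => // y; rewrite lee_fin.
Qed.

Lemma has_gmean_dom A B b : (forall y, 0 <= A y) -> measurable_fun setT A ->
  has_gmean B b -> (forall y, A y <= B y) -> exists a, has_gmean A a.
Proof.
move=> A0 mA hB AB; have aA := admissible_EFin A0 mA.
have aB := has_gmean_admissible hB; case: hB => [_ _ EB].
have h0 : (0 <= gsmooths s l (EFin \o A) x)%E by case: (admissible_gsmooths s l aA).
have h1 : (gsmooths s l (EFin \o A) x <= b%:E)%E.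
  by rewrite -EB; apply: le_gsmooths => // y; rewrite lee_fin.
exists (fine (gsmooths s l (EFin \o A) x)); split => //.
by rewrite fineK// ge0_fin_numE// (le_lt_trans h1)// ltry.
Qed.

(** [has_gmean] covers only nonnegative functions, so the mean of an expression with terms of both
    signs is read off from a sum. *)
Lemma has_gmeanB A a B b C : (forall y, 0 <= C y) -> measurable_fun setT C ->
  has_gmean A a -> has_gmean B b -> (forall y, C y + A y = B y) ->
  has_gmean C (b - a).
Proof.
move=> C0 mC hA hB E.
have [c hC] : exists c, has_gmean C c.
  apply: (has_gmean_dom C0 mC hB) => y; rewrite -E lerDl; by case: hA.
have hCA := has_gmeanD hC hA.
have bE : b = c + a.
  apply/eqP; rewrite eq_le (has_gmean_le hB hCA) ?(has_gmean_le hCA hB)// => y; by rewrite E.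
by rewrite bE addrK.
Qed.

End SmoothingExpectation.

(** * Soft maximum and its dependence on the covariance *)

Section Comparison.
Context {R : realType} {K : finType}.
Implicit Types (l : seq (K -> R)) (x y : @pspace R K).

Definition cov l (k j : K) : R := \sum_(v <- l) v k * v j.

Definition sumexp (be : R) y : R := \sum_k expR (be * y k).

Definition softmax_pow (be th : R) y : R := sumexp be y `^ th.

Lemma cov_ge0 l k : 0 <= cov l k k.
Proof. by apply: sumr_ge0 => v _; rewrite -expr2 sqr_ge0. Qed.

Lemma dot_delta (a : R) k (y : K -> R) : dot (fun j => a * (j == k)%:R) y = a * y k.
Proof.
rewrite /dot (bigD1 k)//= eqxx mulr1 big1 ?addr0// => j jk.
by rewrite (negbTE jk) mulr0 mul0r.
Qed.

Lemma sumexp_gt0 be y (k0 : K) : 0 < sumexp be y.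
Proof.
rewrite /sumexp (bigD1 k0)//=; apply: ltr_pwDl; first exact: expR_gt0.
by apply: sumr_ge0 => i _; exact: expR_ge0.
Qed.

Lemma measurable_expcoord (be d : R) k :
  measurable_fun setT (fun y : @pspace R K => expR (be * y k + d)).
Proof.
apply: measurableT_comp => //; apply: measurable_funD => //.
by apply: measurable_funM => //; exact: measurable_coord.
Qed.

Lemma measurable_sumexp be : measurable_fun setT (sumexp be : @pspace R K -> R).
Proof.
apply: measurable_sum => k.
apply: measurableT_comp => //; apply: measurable_funM => //.
exact: measurable_coord.
Qed.

Lemma measurable_softmax_pow be th :
  measurable_fun setT (softmax_pow be th : @pspace R K -> R).
Proof.
exact: (measurableT_comp (measurable_powR th) (measurable_sumexp be)).
Qed.

Lemma admissible_softmax_pow be th :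
  admissible (EFin \o softmax_pow be th : @pspace R K -> \bar R).
Proof.
apply: admissible_EFin; last exact: measurable_softmax_pow.
by move=> y; exact: powR_ge0.
Qed.

Section OneStep.
Variables (be th t : R) (x : @pspace R K) (k0 : K).
Hypotheses (t0 : 0 < t) (th01 : 0 <= th <= 1).

Let tn : t != 0. Proof. by rewrite gt_eqF. Qed.
(** [p] are the Gibbs weights at the base point [x] and [e k] the growth factors away from it, so
    [Z] is the ratio of [sumexp] at [y] and at [x]; [expR (q l k)] is the mean of [e k]. *)
Let p k := expR (be * x k) / sumexp be x.
Let e k (y : @pspace R K) := expR (be * y k + - (be * x k)).
Let Z (y : @pspace R K) := \sum_k p k * e k y.
Let q l k := t ^+ 2 / 2 * be ^+ 2 * cov l k k.

Let p0 k : 0 <= p k.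
Proof. by rewrite divr_ge0 ?expR_ge0// ltW// sumexp_gt0. Qed.

Let p1 : \sum_k p k = 1.
Proof. by rewrite -mulr_suml divff// gt_eqF// sumexp_gt0. Qed.

Let ZE y : Z y = sumexp be y / sumexp be x.
Proof.
rewrite /Z mulr_suml; apply: eq_bigr => k _; rewrite /p /e expRD expRN.
by field; rewrite gt_eqF ?sumexp_gt0//= gt_eqF ?expR_gt0.
Qed.

Let Z0 y : 0 < Z y. Proof. by rewrite ZE divr_gt0// sumexp_gt0. Qed.

Let e0 k y : 0 <= e k y. Proof. exact: expR_ge0. Qed.

Let softmax_powE y : softmax_pow be th y = softmax_pow be th x * Z y `^ th.
Proof.
rewrite /softmax_pow -powRM ?ltW ?sumexp_gt0//.
by rewrite ZE mulrC divfK// gt_eqF// sumexp_gt0.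
Qed.

(** The off-diagonal covariances enter the comparison only through these second moments. *)
Let mean_ee l k j : has_gmean t l x (fun y => e k y * e j y)
  (expR (t ^+ 2 / 2 * be ^+ 2 * (cov l k k + cov l j j + 2 * cov l k j))).
Proof.
pose c i := be * (i == k)%:R + be * (i == j)%:R.
have cE (y : K -> R) : dot c y = be * y k + be * y j.
  by rewrite -!dot_delta /dot -big_split/=; apply: eq_bigr => i _; rewrite -mulrDl.
have := has_gmean_expR l x c (- (be * x k) - be * x j) tn.
rewrite cE (_ : be * x k + _ + _ = 0); last by ring.
rewrite add0r (_ : t ^+ 2 / 2 * _ = t ^+ 2 / 2 * be ^+ 2 * (cov l k k + cov l j j + 2 * cov l k j)).
  congr (has_gmean _ _ _ _ _); apply/funext => y.
  by rewrite cE -expRD; congr expR; ring.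
rewrite -[RHS]mulrA; congr (_ * _); rewrite /cov mulr_sumr -!big_split/= mulr_sumr.
by apply: eq_bigr => v _; rewrite cE; ring.
Qed.

Let mean_en l k n : has_gmean t l x (fun y => e k y ^+ n) (expR (n%:R ^+ 2 * q l k)).
Proof.
have := has_gmean_expR l x (fun i => n%:R * be * (i == k)%:R) (- (n%:R * be * x k)) tn.
rewrite dot_delta subrr add0r.
rewrite (_ : t ^+ 2 / 2 * _ = n%:R ^+ 2 * q l k).
  congr (has_gmean _ _ _ _ _); apply/funext => y.
  by rewrite dot_delta -expRM_natl; congr expR; ring.
rewrite /q /cov !mulr_sumr.
by apply: eq_bigr => v _; rewrite dot_delta; ring.
Qed.

Let mean_Z l : has_gmean t l x Z (\sum_k p k * expR (q l k)).
Proof.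
apply: has_gmean_sum => k; apply: has_gmeanZ => //.
by have := mean_en l k 1; rewrite expr1n mul1r.
Qed.

Let mean_Z2 l : has_gmean t l x (fun y => Z y ^+ 2) (\sum_k \sum_j p k * (p j *
  expR (t ^+ 2 / 2 * be ^+ 2 * (cov l k k + cov l j j + 2 * cov l k j)))).
Proof.
have -> : (fun y => Z y ^+ 2) = (fun y => \sum_k \sum_j p k * (p j * (e k y * e j y))).
  apply/funext => y; rewrite expr2 /Z mulr_suml; apply: eq_bigr => k _.
  by rewrite mulr_sumr; apply: eq_bigr => j _; ring.
apply: has_gmean_sum => k; apply: has_gmean_sum => j.
by apply: has_gmeanZ => //; apply: has_gmeanZ.
Qed.

(** A majorant of the cubic Taylor remainder: [cube_le] applied to Z - 1, then Jensen's inequality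
    for the weights [p]. It is polynomial in the [e k], so its mean is explicit. *)
Let rem y := 8 * \sum_k p k * (t * (e k y - 1) ^+ 2 + (e k y - 1) ^+ 4 / t).

Let cube_rem y : 16 * `|Z y - 1| ^+ 3 <= rem y.
Proof.
have ZB : Z y - 1 = \sum_k p k * (e k y - 1).
  by rewrite -[in LHS]p1 /Z -sumrB; apply: eq_bigr => k _; ring.
have h2 : (Z y - 1) ^+ 2 <= \sum_k p k * (e k y - 1) ^+ 2.
  by rewrite ZB; exact: jensen_sqr.
have h4 : (Z y - 1) ^+ 4 <= \sum_k p k * (e k y - 1) ^+ 4.
  rewrite (exprM _ 2 2); apply: (@le_trans _ _ ((\sum_k p k * (e k y - 1) ^+ 2) ^+ 2)).
    by rewrite lerXn2r// nnegrE; [exact: sqr_ge0|apply: sumr_ge0 => k _; rewrite mulr_ge0// sqr_ge0].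
  under [leRHS]eq_bigr do rewrite (exprM _ 2 2).
  exact: jensen_sqr.
have hc := cube_le (Z y - 1) t0.
have -> : rem y = 8 * (t * (\sum_k p k * (e k y - 1) ^+ 2) + (\sum_k p k * (e k y - 1) ^+ 4) / t).
  rewrite /rem; congr (_ * _); rewrite mulr_sumr mulr_suml -big_split/=.
  by apply: eq_bigr => k _; ring.
have : t * (Z y - 1) ^+ 2 <= t * (\sum_k p k * (e k y - 1) ^+ 2) by rewrite ler_pM2l.
have : (Z y - 1) ^+ 4 / t <= (\sum_k p k * (e k y - 1) ^+ 4) / t by rewrite ler_pM2r ?invr_gt0.
by lra.
Qed.

(** The powers are expanded, and [e k y ^+ n] has mean exp(n^2 q); the odd powers, which carry a
    negative sign, go to the other side for [has_gmeanB]. *)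
Let mean_rem1 l k : has_gmean t l x (fun y => t * (e k y - 1) ^+ 2 + (e k y - 1) ^+ 4 / t)
  ((t + 6 / t) * expR (4 * q l k) + t^-1 * expR (16 * q l k) + (t + t^-1)
   - ((2 * t + 4 / t) * expR (q l k) + 4 / t * expR (9 * q l k))).
Proof.
have m1 : has_gmean t l x (fun y => e k y) (expR (q l k)).
  by have := mean_en l k 1; rewrite expr1n mul1r.
have m2 := mean_en l k 2; have m3 := mean_en l k 3; have m4 := mean_en l k 4.
have me : measurable_fun setT (e k) by exact: measurable_expcoord.
have ti : 0 < t^-1 by rewrite invr_gt0.
have [t1 ti1] := (ltW t0, ltW ti).
have c1 : 0 <= 2 * t + 4 / t by rewrite addr_ge0 ?mulr_ge0.
have c2 : 0 <= 4 / t by rewrite mulr_ge0.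
have c3 : 0 <= t + 6 / t by rewrite addr_ge0 ?mulr_ge0.
have c4 : 0 <= t + t^-1 by rewrite addr_ge0.
have e4 : (4%:R ^+ 2 : R) = 16 by rewrite -natrX.
have e3 : (3%:R ^+ 2 : R) = 9 by rewrite -natrX.
have e2 : (2%:R ^+ 2 : R) = 4 by rewrite -natrX.
rewrite e2 in m2; rewrite e3 in m3; rewrite e4 in m4.
apply: (has_gmeanB (A := fun y => (2 * t + 4 / t) * e k y + 4 / t * e k y ^+ 3)
  (B := fun y => (t + 6 / t) * e k y ^+ 2 + t^-1 * e k y ^+ 4 + (t + t^-1))).
- move=> y; apply: addr_ge0; first by rewrite mulr_ge0 ?sqr_ge0.
  by rewrite mulr_ge0// (exprM _ 2 2) sqr_ge0.
- apply: measurable_funD; apply: measurable_funM => //;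
  by apply: measurable_funX; exact: measurable_funB.
- by apply: has_gmeanD; apply: has_gmeanZ.
- apply: has_gmeanD; last exact: has_gmean_cst.
  by apply: has_gmeanD; apply: has_gmeanZ.
- by move=> y; field.
Qed.

Let mean_rem l (b : R) : (forall k, q l k <= b * t ^+ 2) -> 32 * b * t ^+ 2 <= 1 ->
  exists2 r, has_gmean t l x rem r & r <= 8 * (3 * b + 704 * b ^+ 2) * t ^+ 3.
Proof.
move=> qb bt.
have q0 k : 0 <= q l k.
  by rewrite /q mulr_ge0 ?cov_ge0// mulr_ge0 ?sqr_ge0// divr_ge0 ?sqr_ge0.
eexists.
  rewrite /rem; apply: has_gmeanZ => //; apply: has_gmean_sum => k.
  by apply: has_gmeanZ => //; exact: mean_rem1.
rewrite -mulrA ler_pM2l//.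
have -> : (3 * b + 704 * b ^+ 2) * t ^+ 3 =
    \sum_k p k * ((3 * b + 704 * b ^+ 2) * t ^+ 3) by rewrite -mulr_suml p1 mul1r.
apply: ler_sum => k _; rewrite ler_wpM2l//.
have := qb k; have := q0 k; move: (q l k) => z z0 zb.
have z1 : 16 * z <= 2^-1 by lra.
have h1 := expR_ge1Dx z; have h9 := expR_ge1Dx (9 * z).
have h4 : expR (4 * z) <= 1 + 4 * z + 2 * (4 * z) ^+ 2 by apply: expR_ub; lra.
have h16 := expR_ub z1.
have ti : 0 < t^-1 by rewrite invr_gt0.
have E : (t + 6 / t) * expR (4 * z) + t^-1 * expR (16 * z) + (t + t^-1) -
    ((2 * t + 4 / t) * expR z + 4 / t * expR (9 * z)) =
    t * (expR (4 * z) + 1 - 2 * expR z) +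
    t^-1 * (6 * expR (4 * z) + expR (16 * z) + 1 - 4 * expR z - 4 * expR (9 * z)) by ring.
rewrite E.
(* The linear terms leave 4z - 2z, and 32 z^2 <= z by the assumption on the step size. *)
have k1 : expR (4 * z) + 1 - 2 * expR z <= 3 * (b * t ^+ 2).
  have : z * (32 * z) <= z * 1 by rewrite ler_wpM2l//; lra.
  by rewrite expr2 in h4; lra.
(* The constant and linear terms cancel; 704 = 6 x 32 + 512 collects the quadratic errors of
   [expR_ub] at 4z and 16z. *)
have k2 : 6 * expR (4 * z) + expR (16 * z) + 1 - 4 * expR z - 4 * expR (9 * z) <=
    704 * (b * t ^+ 2) ^+ 2.
  have : z ^+ 2 <= (b * t ^+ 2) ^+ 2 by rewrite lerXn2r// nnegrE (le_trans z0).
  by rewrite !exprMn -!natrX in h4 h16; lra.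
have -> : (3 * b + 704 * b ^+ 2) * t ^+ 3 =
    t * (3 * (b * t ^+ 2)) + t^-1 * (704 * (b * t ^+ 2) ^+ 2) by field.
by apply: lerD; rewrite ler_pM2l.
Qed.

Let mZth : measurable_fun setT (fun y => Z y `^ th).
Proof.
apply: (measurableT_comp (measurable_powR th)).
by apply: measurable_sum => k; apply: measurable_funM => //; exact: measurable_expcoord.
Qed.

Let mean_Zth l : exists r, has_gmean t l x (fun y => Z y `^ th) r.
Proof.
have /andP[a0 a1] := th01.
apply: (has_gmean_dom _ mZth (B := fun y => (1 - th) + th * Z y)).
- by move=> y; exact: powR_ge0.
- by apply: has_gmeanD; [apply: has_gmean_cst; lra|apply: has_gmeanZ => //; exact: mean_Z].
- by move=> y; apply: (le_trans (powR_le_affine (Z0 y) th01)); lra.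
Qed.

(** By Jensen's inequality ln Z is at least an affine form vanishing at [x], and the exponential of
    a centred Gaussian has mean at least 1. This lower bound later converts an additive error into a
    multiplicative one. *)
Let mean_Zth_ge1 l r : has_gmean t l x (fun y => Z y `^ th) r -> 1 <= r.
Proof.
move=> hr; have /andP[a0 a1] := th01.
pose c k := th * (be * p k); pose d := - dot c x.
have hE := has_gmean_expR l x c d tn.
apply: (@le_trans _ _ (expR (dot c x + d + t ^+ 2 / 2 * \sum_(v <- l) dot c v ^+ 2))).
  rewrite /d subrr add0r -[leLHS]expR0 ler_expR mulr_ge0 ?divr_ge0 ?sqr_ge0//.
  by apply: sumr_ge0 => v _; exact: sqr_ge0.
apply: (has_gmean_le hE hr) => y.
have -> : dot c y + d = th * \sum_k p k * (be * y k + - (be * x k)).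
  rewrite /d /dot -sumrB mulr_sumr; apply: eq_bigr => k _; rewrite /c; ring.
rewrite powR_expR// ler_expR ler_wpM2l// -ler_expR lnK ?posrE//.
exact: jensen_expR.
Qed.

(* With Z the ratio of [sumexp] after and before the move, E Z is the same for
   [la] and [lb] and E Z^2 is at least as large for [la], both exactly; as z^th
   is concave, only the cubic Taylor remainder costs O(t^3). *)
Lemma smoothing_step la lb (b : R) :
  (forall k, cov la k k = cov lb k k) ->
  (forall k j, cov lb k j <= cov la k j) ->
  (forall k, be ^+ 2 / 2 * cov la k k <= b) -> 32 * b * t ^+ 2 <= 1 ->
  (gsmooths t la (EFin \o softmax_pow be th) x <=
   (1 + 16 * (3 * b + 704 * b ^+ 2) * t ^+ 3)%:E *
     gsmooths t lb (EFin \o softmax_pow be th) x)%E.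
Proof.
move=> Ckk Ckj hb bt.
have /andP[a0 a1] := th01.
set M := 8 * (3 * b + 704 * b ^+ 2).
have qE k : q la k = q lb k by rewrite /q Ckk.
have qb k : q la k <= b * t ^+ 2.
  have -> : q la k = be ^+ 2 / 2 * cov la k k * t ^+ 2 by rewrite /q; ring.
  by rewrite ler_wpM2r ?sqr_ge0.
have qb' k : q lb k <= b * t ^+ 2 by rewrite -qE.
have [ra hra] := mean_Zth la; have [rb hrb] := mean_Zth lb.
have rb1 := mean_Zth_ge1 hrb.
have [sa hsa sab] := mean_rem qb bt; have [sb hsb sbb] := mean_rem qb' bt.
have hZa := mean_Z la; have hZb := mean_Z lb.
have hZa2 := mean_Z2 la; have hZb2 := mean_Z2 lb.
rewrite (eq_bigr (fun k => p k * expR (q lb k))) in hZa; last by move=> k _; rewrite qE.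
set m1 := \sum_k _ * _ in hZa hZb.
set m2a := \sum_k _ in hZa2; set m2b := \sum_k _ in hZb2.
have m2 : m2b <= m2a.
  apply: ler_sum => k _; apply: ler_sum => j _; rewrite !ler_wpM2l// ler_expR !Ckk.
  rewrite ler_wpM2l ?(mulr_ge0 (divr_ge0 (sqr_ge0 _) _) (sqr_ge0 _))//.
  by rewrite lerD2l ler_pM2l.
(* [kap] is the second-order Taylor coefficient. Its term kap (Z - 1)^2 is split as kap (Z^2 + 1)
   against 2 kap Z, so that both sides stay nonnegative. *)
pose kap := th * (1 - th) / 2.
have kap0 : 0 <= kap by rewrite /kap !mulr_ge0// subr_ge0.
have taylor y := powR_taylor2 (Z0 y) th01.
have Ua : ra + kap * (m2a + 1) <= (1 - th) + (th + 2 * kap) * m1 + sa.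
  apply: (@has_gmean_le _ _ t la x (fun y => Z y `^ th + kap * (Z y ^+ 2 + 1)) _
     (fun y => (1 - th) + (th + 2 * kap) * Z y + rem y)).
  - apply: has_gmeanD => //; apply: has_gmeanZ => //.
    by apply: has_gmeanD => //; exact: has_gmean_cst.
  - apply: has_gmeanD => //; apply: has_gmeanD; first by apply: has_gmean_cst; lra.
    by apply: has_gmeanZ => //; lra.
  - move=> y; have := taylor y; rewrite ler_norml => /andP[_].
    have := cube_rem y; rewrite /kap expr2 => ? ?; lra.
have Lb : (1 - th) + (th + 2 * kap) * m1 <= rb + kap * (m2b + 1) + sb.
  apply: (@has_gmean_le _ _ t lb x (fun y => (1 - th) + (th + 2 * kap) * Z y) _
    (fun y => Z y `^ th + kap * (Z y ^+ 2 + 1) + rem y)).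
  - apply: has_gmeanD; first by apply: has_gmean_cst; lra.
    by apply: has_gmeanZ => //; lra.
  - apply: has_gmeanD => //; apply: has_gmeanD => //; apply: has_gmeanZ => //.
    by apply: has_gmeanD => //; exact: has_gmean_cst.
  - move=> y; have := taylor y; rewrite ler_norml => /andP[+ _].
    have := cube_rem y; rewrite /kap expr2 => ? ?; lra.
have kk : kap * (m2b + 1) <= kap * (m2a + 1) by rewrite ler_wpM2l// lerD2r.
(* The additive error 2 M t^3 is absorbed into a multiple of [rb], which is at least 1. *)
have rab : ra <= (1 + 2 * (M * t ^+ 3)) * rb.
  have Mt : 0 <= M * t ^+ 3.
    have b0 : 0 <= b by apply: le_trans (hb k0); rewrite mulr_ge0 ?cov_ge0// divr_ge0 ?sqr_ge0.
    apply: mulr_ge0; last by apply: exprn_ge0; exact: ltW.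
    apply: mulr_ge0; first exact: ler0n.
    by apply: addr_ge0; apply: mulr_ge0; rewrite ?ler0n ?sqr_ge0.
  rewrite -/M in sab sbb; clearbody M m1 m2a m2b kap.
  have : ra <= rb + 2 * (M * t ^+ 3) by lra.
  have : 0 <= (M * t ^+ 3) * (rb - 1) by rewrite mulr_ge0// subr_ge0.
  by lra.
have f0 : 0 <= softmax_pow be th x by exact: powR_ge0.
have fE l r : has_gmean t l x (fun y => Z y `^ th) r ->
    gsmooths t l (EFin \o softmax_pow be th) x = (softmax_pow be th x * r)%:E.
  move=> /(has_gmeanZ f0)[_ _ <-]; congr (gsmooths _ _ _ _).
  by apply/funext => y /=; rewrite softmax_powE.
rewrite (fE _ _ hra) (fE _ _ hrb) -EFinM lee_fin mulrCA ler_wpM2l//.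
have -> : 16 * (3 * b + 704 * b ^+ 2) * t ^+ 3 = 2 * (M * t ^+ 3) by rewrite /M; ring.
exact: rab.
Qed.

End OneStep.

End Comparison.

(** * Slepian-Kahane comparison *)

Section SlepianKahane.
Context {R : realType} {K : finType}.
Implicit Types (l : seq (K -> R)) (x : @pspace R K) (F : @pspace R K -> \bar R).

Definition repeat_dirs n l := flatten (nseq n l).

Lemma gsmooths_cat s l l' F :
  gsmooths s (l ++ l') F = gsmooths s l (gsmooths s l' F).
Proof. exact: foldr_cat. Qed.

Lemma gsmooths_repeat t n l F : 0 < t -> admissible F ->
  gsmooths t (repeat_dirs n.+1 l) F = gsmooths (Num.sqrt n.+1%:R * t) l F.
Proof.
move=> t0 aF; rewrite /repeat_dirs; elim: n => [|n ih].
  by rewrite /= cats0 sqrtr1 mul1r.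
have -> : flatten (nseq n.+2 l) = l ++ flatten (nseq n.+1 l) by [].
have t1 : 0 < Num.sqrt n.+1%:R * t by rewrite mulr_gt0// sqrtr_gt0 ltr0n.
rewrite gsmooths_cat.
rewrite ih.
rewrite (gsmooths_conv l t0 t1 aF).
congr (gsmooths _ l F).
rewrite exprMn sqr_sqrtr ?ler0n// -[X in X + _]mul1r -mulrDl.
by rewrite sqrtrM ?addr_ge0 ?ler0n// sqrtr_sqr gtr0_norm// -(natrD _ 1).
Qed.

(** Blocks are exchanged one at a time: commutation moves one [la] block next to [F], where the
    hypothesis applies, and the remaining blocks follow by induction. *)
Lemma le_gsmooths_repeat t (c : R) la lb F n : 0 <= c -> admissible F ->
  (forall x, gsmooths t la F x <= c%:E * gsmooths t lb F x)%E ->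
  forall x, (gsmooths t (repeat_dirs n la) F x <=
    (c ^+ n)%:E * gsmooths t (repeat_dirs n lb) F x)%E.
Proof.
move=> c0 aF h; rewrite /repeat_dirs; elim: n => [|n ih] x.
  by rewrite expr0 mul1e.
rewrite ![flatten (nseq n.+1 _)]/(_ ++ flatten (nseq n _)) !gsmooths_cat.
set fa := flatten (nseq n la) in ih *; set fb := flatten (nseq n lb) in ih *.
have aG l : admissible (gsmooths t l F) by exact: admissible_gsmooths.
have acG (k : R) l : 0 <= k -> admissible (fun x => k%:E * gsmooths t l F x)%E.
  move=> k0; apply: (admissibleM (F := fun=> k%:E) _ (aG l)).
  by apply: admissible_cst; rewrite lee_fin.
rewrite gsmooths_comm//.
apply: (le_trans (le_gsmooths t fa (aG _) (acG c lb c0) h x)).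
rewrite gsmoothsZ ?lee_fin// gsmooths_comm//.
rewrite exprS EFinM -muleA lee_wpmul2l ?lee_fin//.
have cn0 : 0 <= c ^+ n by rewrite exprn_ge0.
apply: (le_trans (le_gsmooths t lb (aG _) (acG (c ^+ n) fb cn0) ih x)).
by rewrite gsmoothsZ ?lee_fin.
Qed.

(* Slepian-Kahane comparison: time is cut into n + 1 steps of variance
   s^2 / (n + 1), each of which costs a factor 1 + O(n^(-3/2)). *)
Theorem slepian_kahane (be th s : R) la lb (k0 : K) x : 0 < s -> 0 <= th <= 1 ->
  (forall k, cov la k k = cov lb k k) ->
  (forall k j, cov lb k j <= cov la k j) ->
  (gsmooths s la (EFin \o softmax_pow be th) x <=
   gsmooths s lb (EFin \o softmax_pow be th) x)%E.
Proof.
move=> s0 th01 Ckk Ckj; set F := EFin \o _.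
have aF : admissible F by exact: admissible_softmax_pow.
pose b := be ^+ 2 / 2 * \sum_k cov la k k.
have b0 : 0 <= b.
  rewrite mulr_ge0 ?divr_ge0 ?sqr_ge0//; apply: sumr_ge0 => k _; exact: cov_ge0.
have hb k : be ^+ 2 / 2 * cov la k k <= b.
  rewrite ler_wpM2l ?divr_ge0 ?sqr_ge0//.
  by rewrite (bigD1 k)//= lerDl; apply: sumr_ge0 => j _; exact: cov_ge0.
pose M := 16 * (3 * b + 704 * b ^+ 2).
have M0 : 0 <= M.
  apply: mulr_ge0; first exact: ler0n.
  by apply: addr_ge0; apply: mulr_ge0; rewrite ?ler0n ?sqr_ge0.
(* With t = s / sqrt(n + 1), the accumulated factor (1 + M t^3)^(n + 1) is at most exp(M s^3 /
   sqrt(n + 1)). *)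
have key n : 32 * b * s ^+ 2 <= n.+1%:R ->
  (gsmooths s la F x <= (expR (M * s ^+ 3 / Num.sqrt n.+1%:R))%:E * gsmooths s lb F x)%E.
  move=> hn; pose q : R := Num.sqrt n.+1%:R; pose t := s / q.
  have q0 : 0 < q by rewrite sqrtr_gt0 ltr0n.
  have q2 : q ^+ 2 = n.+1%:R by rewrite sqr_sqrtr ?ler0n.
  have t0 : 0 < t by rewrite divr_gt0.
  have tE : q * t = s by rewrite mulrC divfK ?gt_eqF.
  have bt : 32 * b * t ^+ 2 <= 1.
    by rewrite /t expr_div_n q2 mulrA ler_pdivrMr ?ltr0n// mul1r.
  have c0 : 0 <= 1 + M * t ^+ 3 by rewrite addr_ge0// mulr_ge0// exprn_ge0// ltW.
  have := @le_gsmooths_repeat t (1 + M * t ^+ 3) la lb F n.+1 c0 aF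
    (fun z => smoothing_step z k0 t0 th01 Ckk Ckj hb bt) x.
  rewrite (gsmooths_repeat n la t0 aF) (gsmooths_repeat n lb t0 aF) tE.
  move=> /le_trans; apply.
  apply: lee_wpmul2r; first by case: (admissible_gsmooths s lb aF).
  rewrite lee_fin.
  have -> : M * s ^+ 3 / q = n.+1%:R * (M * t ^+ 3).
    by rewrite -q2 /t; field; rewrite gt_eqF.
  by rewrite expRM_natl lerXn2r// ?nnegrE ?expR_ge0// expR_ge1Dx.
have B0 : (0 <= gsmooths s lb F x)%E by case: (admissible_gsmooths s lb aF).
move: B0 key; set B := gsmooths s lb F x; set A := gsmooths s la F x.
case: B => [B| |] //; last by move=> *; rewrite leey.
rewrite lee_fin => B0 key; apply/lee_addgt0Pr => e e0.
(* Multiplying [B] by exp(eta) adds at most [e]; [B + 1] avoids division by zero. *)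
pose eta := ln (1 + e / (B + 1)).
have B1 : 0 < B + 1 by rewrite ltr_wpDl.
have eB : 0 < e / (B + 1) by rewrite divr_gt0.
have eta0 : 0 < eta by rewrite ln_gt0// ltrDl.
(* [m] is large enough both for the step-size condition of [key] and for the exponent to be at most
   [eta]. *)
pose m := Num.truncn (32 * b * s ^+ 2 + (M * s ^+ 3 / eta) ^+ 2).
have hm : 32 * b * s ^+ 2 + (M * s ^+ 3 / eta) ^+ 2 <= m.+1%:R.
  by rewrite ltW// truncnS_gt.
have h1 : 32 * b * s ^+ 2 <= m.+1%:R.
  by apply: le_trans hm; rewrite lerDl sqr_ge0.
apply: (le_trans (key m h1)); rewrite -EFinM -EFinD lee_fin.
have : expR (M * s ^+ 3 / Num.sqrt m.+1%:R) <= 1 + e / (B + 1).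
  rewrite -[leRHS]lnK ?posrE ?addr_gt0// ler_expR -/eta.
  rewrite ler_pdivrMr ?sqrtr_gt0 ?ltr0n// [leRHS]mulrC -ler_pdivrMr//.
  have u0 : 0 <= M * s ^+ 3 / eta.
    by apply: divr_ge0 (ltW eta0); rewrite mulr_ge0// exprn_ge0// ltW.
  rewrite -(ger0_norm u0) -sqrtr_sqr ler_wsqrtr//.
  by apply: le_trans hm; rewrite lerDr mulr_ge0 ?sqr_ge0// mulr_ge0.
move=> /(ler_wpM2r B0) /le_trans; apply.
rewrite mulrDl mul1r lerD2l mulrAC ler_pdivrMr// ler_wpM2l ?ltW//.
by rewrite ltrDl.
Qed.

End SlepianKahane.

(** * Independence and Gaussian families *)

Section ImageMeasure.
Context {d d'} {T : measurableType d} {S : measurableType d'} {R : realType}.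
Variable mu : {finite_measure set T -> \bar R}.
Variables (f : T -> S) (mf : measurable_fun setT f).

(** Carrying the proof of measurability as an argument lets the finite measure structure be attached
    to the term. *)
Definition image_measure of measurable_fun setT f := pushforward mu f.

Local Notation nu := (image_measure mf).

Let nu0 : nu set0 = 0%E.
Proof. by rewrite /image_measure /pushforward preimage_set0 measure0. Qed.

Let nu_ge0 A : (0 <= nu A)%E. Proof. exact: measure_ge0. Qed.

Let nu_sigma_additive : semi_sigma_additive nu.
Proof. exact: (@measure_semi_sigma_additive _ _ _ (pushforward mu f)). Qed.

HB.instance Definition _ := isMeasure.Build _ _ _ nu nu0 nu_ge0 nu_sigma_additive.

Let nu_fin : fin_num_fun nu.
Proof.
by move=> A mA; apply: fin_num_measure; rewrite -[X in measurable X]setTI; exact: mf.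
Qed.

HB.instance Definition _ := Measure_isFinite.Build _ _ _ nu nu_fin.

Lemma ge0_integral_image (h : S -> \bar R) : measurable_fun setT h ->
  (forall y, 0 <= h y)%E -> (\int[nu]_y h y = \int[mu]_t h (f t))%E.
Proof. by move=> mh h0; rewrite /image_measure ge0_integral_pushforward. Qed.

End ImageMeasure.

Section IndependentPair.
Context {d d1 d2} {T : measurableType d} {S1 : measurableType d1}
  {S2 : measurableType d2} {R : realType}.
Variable mu : {finite_measure set T -> \bar R}.
Variable nu : {sigma_finite_measure set S2 -> \bar R}.
Variables (f : T -> S1) (g : T -> S2).
Hypotheses (mf : measurable_fun setT f) (mg : measurable_fun setT g).
Hypothesis fg : forall A B, measurable A -> measurable B ->
  mu (f @^-1` A `&` g @^-1` B) = (mu (f @^-1` A) * nu B)%E.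

(** The law of the pair agrees with the product measure on rectangles, hence everywhere, and Tonelli
    applies. A finite [mu] of arbitrary mass is what the induction in [integral_gaussian_seq] calls
    for. *)
Lemma integral_independent_pair (h : S1 -> S2 -> \bar R) :
  measurable_fun setT (fun z : S1 * S2 => h z.1 z.2) ->
  (forall x y, 0 <= h x y)%E ->
  (\int[mu]_t h (f t) (g t) = \int[mu]_t \int[nu]_y h (f t) y)%E.
Proof.
move=> mh h0.
have mfg : measurable_fun setT (fun t => (f t, g t)).
  exact: measurable_fun_pair.
transitivity (\int[image_measure mu mfg]_z h z.1 z.2)%E.
  by rewrite ge0_integral_image.
transitivity (\int[image_measure mu mf \x nu]_z h z.1 z.2)%E.
  apply: eq_measure_integral => A mA _; apply/esym/product_measure_unique => //.
transitivity (\int[image_measure mu mf]_x \int[nu]_y h x y)%E.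
  exact: (fubini_tonelli1 (fun z : S1 * S2 => h z.1 z.2) mh (fun z => h0 z.1 z.2)).
apply: ge0_integral_image; last by move=> x; exact: integral_ge0.
exact: (measurable_fun_fubini_tonelli_F (m2 := nu) (fun z : S1 * S2 => h z.1 z.2) mh
  (fun z => h0 z.1 z.2)).
Qed.

End IndependentPair.

Section GaussianFamily.
Context {d} {T : measurableType d} {R : realType} {K I : finType}.
Variables (s : R) (a : I -> K -> R) (xi : I -> T -> R).
Hypothesis mxi : forall i, measurable_fun setT (xi i).

Local Notation gam := (normal_prob 0 s).

Let disp (l : seq I) (x : @pspace R K) (t : T) : @pspace R K :=
  fun k => x k + \sum_(i <- l) xi i t * a i k.

Let measurable_disp l x : measurable_fun setT (disp l x).
Proof.
apply: measurable_pspace => k; apply: measurable_funD => //.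
by apply: measurable_sum => i; exact: measurable_funM.
Qed.

(** Induction on the noises. Peeling off [xi i] requires its independence from the displacement by
    the remaining ones; this follows from the induction hypothesis applied to indicators under [mu]
    restricted to the event that [xi i] lies in [C], which is why [mu] ranges over all finite
    measures. *)
Lemma integral_gaussian_seq (l : seq I) (x : @pspace R K)
    (mu : {finite_measure set T -> \bar R}) (F : @pspace R K -> \bar R) :
  uniq l -> admissible F ->
  (forall B : I -> set R, (forall i, measurable (B i)) ->
    mu (\bigcap_(i in [set` l]) (xi i @^-1` B i)) =
      (mu setT * \prod_(i <- l) gam (B i))%E) ->
  (\int[mu]_t F (fun k => x k + \sum_(i <- l) xi i t * a i k)%R =
   mu setT * gsmooths s [seq a i | i <- l] F x)%E.
Proof.
elim: l mu F => [|i l ih] mu F.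
  move=> _ [mF F0] _ /=.
  under eq_integral => t _ do
    (rewrite (_ : (fun k => _) = x); last by apply/funext => k; rewrite big_nil addr0).
  by rewrite integral_cst// muleC.
move=> /= /andP[il ul] aF hmu; have [mF F0] := aF.
have mpre j (C : set R) : measurable C -> measurable (xi j @^-1` C).
  by move=> mC; rewrite -[X in measurable X]setTI; exact: mxi.
have hl (C : set R) (mC : measurable C) (B : I -> set R) : (forall j, measurable (B j)) ->
    mu (xi i @^-1` C `&` \bigcap_(j in [set` l]) (xi j @^-1` B j)) =
    (mu setT * (gam C * \prod_(j <- l) gam (B j)))%E.
  move=> mB; pose B' j := if j == i then C else B j.
  have mB' j : measurable (B' j) by rewrite /B'; case: ifP.
  have <- : (\prod_(j <- i :: l) gam (B' j) = gam C * \prod_(j <- l) gam (B j))%E.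
    rewrite big_cons /B' eqxx; congr (_ * _)%E; apply: eq_big_seq => j jl.
    by case: eqP => // ji; move: il; rewrite -ji jl.
  rewrite -hmu//.
  congr (mu _); apply/seteqP; split => [t [Ct Bt] j /=|t h].
  + by rewrite inE /B' => /orP[/eqP->|jl]; [rewrite eqxx|case: eqP => [->//|_]; exact: Bt].
  + split; first by have := h i; rewrite /= inE eqxx /B' eqxx => /(_ isT).
    move=> j jl; have := h j; rewrite /= inE jl orbT /B' => /(_ isT).
    by case: eqP => // ji; move: il; rewrite -ji jl.
have hlT (B : I -> set R) : (forall j, measurable (B j)) ->
    mu (\bigcap_(j in [set` l]) (xi j @^-1` B j)) = (mu setT * \prod_(j <- l) gam (B j))%E.
  move=> mB; have := hl setT measurableT B mB; rewrite preimage_setT setTI => ->.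
  by rewrite [gam setT]probability_setT mul1e.
have fgi (A : set (@pspace R K)) (C : set R) : measurable A -> measurable C ->
    mu (disp l x @^-1` A `&` xi i @^-1` C) = (mu (disp l x @^-1` A) * gam C)%E.
  move=> mA mC.
  have a1 : admissible (EFin \o \1_A : @pspace R K -> \bar R).
    by apply: admissible_EFin => //; exact: measurable_indic.
  have mD := mpre i C mC.
  have Doo : (mu (xi i @^-1` C) < +oo)%E by rewrite ltey_eq fin_num_measure.
  have mA' : measurable (disp l x @^-1` A).
    by rewrite -[X in measurable X]setTI; exact: measurable_disp.
  have int1 (m : {finite_measure set T -> \bar R}) :
      (\int[m]_t (EFin \o \1_A) (disp l x t))%E = m (disp l x @^-1` A).
    by rewrite (integral_indic m measurableT mA') setIT.
  have hC : mu (xi i @^-1` C) = (mu setT * gam C)%E.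
    have := hl C mC (fun=> setT) (fun=> measurableT).
    rewrite [X in _ `&` X](_ : _ = setT); last by apply/seteqP; split.
    rewrite setIT => ->; rewrite big1 ?mule1// => j _; exact: probability_setT.
  have rT : mfrestr mD Doo setT = (mu setT * gam C)%E by rewrite /mfrestr /mrestr setTI.
  have E1 : (mfrestr mD Doo (disp l x @^-1` A) =
      mfrestr mD Doo setT * gsmooths s [seq a i | i <- l] (EFin \o \1_A) x)%E.
    rewrite -(int1 (mfrestr mD Doo)); apply: ih => // B mB.
    rewrite [X in (X * _)%E]rT.
    rewrite -[LHS]/(mu (\bigcap_(j in [set` l]) (xi j @^-1` B j) `&` xi i @^-1` C)).
    by rewrite setIC hl// muleA.
  have E2 : (mu (disp l x @^-1` A) =
      mu setT * gsmooths s [seq a i | i <- l] (EFin \o \1_A) x)%E.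
    by rewrite -(int1 mu); exact: ih.
  by rewrite -[LHS]/(mfrestr mD Doo (disp l x @^-1` A)) E1 E2 rT muleAC.
transitivity (\int[mu]_t F (fun k => disp l x t k + xi i t * a i k)%R)%E.
  apply: eq_integral => t _; congr F; apply/funext => k.
  by rewrite big_cons /disp addrCA addrC.
rewrite (integral_independent_pair (nu := gam) (measurable_disp l x) (mxi i) fgi
  (h := fun y r => F (fun k => y k + r * a i k))) => //; last first.
  by apply: (measurableT_comp mF); exact: measurable_move.
transitivity (mu setT * gsmooths s [seq a j | j <- l] (gsmooth s (a i) F) x)%E; last first.
  by rewrite -(gsmooth_gsmooths s s (a i) _ aF).
exact: (ih mu _ ul (admissible_gsmooth s (a i) aF) hlT).
Qed.

End GaussianFamily.

(** * Moment generating functions *)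

Section MomentGeneratingBound.
Context {R : realType} {K : finType}.
Implicit Types (x y : @pspace R K) (F : @pspace R K -> \bar R).

Lemma softmax_pow_ge (be th : R) y k : 0 <= th -> expR (be * th * y k) <= softmax_pow be th y.
Proof.
move=> th0; rewrite mulrAC expRM; apply: ge0_ler_powR => //.
- by rewrite nnegrE expR_ge0.
- by rewrite nnegrE ltW// sumexp_gt0.
- rewrite /sumexp (bigD1 k)//= lerDl.
  by apply: sumr_ge0 => i _; exact: expR_ge0.
Qed.

Lemma softmax_pow_le (be th : R) y M : 0 <= th -> 0 <= be -> (forall k, y k <= M) ->
  softmax_pow be th y <= #|K|%:R `^ th * expR (be * th * M).
Proof.
move=> th0 be0 yM; rewrite mulrAC expRM -powRM ?ler0n ?expR_ge0//.
apply: ge0_ler_powR => //.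
- by rewrite nnegrE; apply: sumr_ge0 => i _; exact: expR_ge0.
- by rewrite nnegrE mulr_ge0 ?ler0n ?expR_ge0.
- apply: (@le_trans _ _ (\sum_(k : K) expR (be * M))).
    by apply: ler_sum => k _; rewrite ler_expR ler_wpM2l.
  by rewrite sumr_const mulr_natl.
Qed.

(* The linear form is replaced by squares through
   [r v <= r^2 / (2 tau) + tau v^2 / 2] with [tau = g + z], [z = la s^2]. *)
Lemma gsmooths_exp_bound (s la A : R) (l : seq ((K -> R) * R)) F x M :
  0 < s -> 0 <= la -> 0 <= A -> admissible F ->
  (forall y M', (forall k, y k <= M') -> (F y <= (A * expR (la * M'))%:E)%E) ->
  all (fun p => 0 < p.2) l ->
  (forall k, x k + \sum_(p <- l) (p.2 + la * s ^+ 2) / 2 * p.1 k ^+ 2 <= M) ->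
  (gsmooths s [seq p.1 | p <- l] F x <=
   (A * expR (la * M + \sum_(p <- l) la * s ^+ 2 / (2 * p.2)))%:E)%E.
Proof.
move=> s0 la0 A0 aF hF; set z := la * s ^+ 2.
have z0 : 0 <= z by rewrite mulr_ge0// sqr_ge0.
elim: l x M => [|[v g] l ih] x M /=.
  move=> _ xM; rewrite big_nil addr0; apply: hF => k.
  by have := xM k; rewrite big_nil addr0.
move=> /andP[g0 gl] xM; rewrite big_cons/=.
set S := \sum_(p <- l) _.
have tau0 : 0 < g + z by rewrite ltr_pwDl.
(* The coefficient is fixed by la r^2 / (2 (g + z)) = al r^2 / (2 s^2), and al < 1 makes the
   chi-square integral finite. *)
pose al := z / (g + z).
have al1 : al < 1 by rewrite ltr_pdivrMr// mul1r ltrDr.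
have bound (r : R) : (gsmooths s [seq p.1 | p <- l] F (fun k => x k + r * v k)%R <=
    (A * expR (la * M + S))%:E * (expR (al * r ^+ 2 / (2 * s ^+ 2)))%:E)%E.
  apply: (le_trans (ih (fun k => x k + r * v k) (M + r ^+ 2 / (2 * (g + z))) gl _)).
    move=> k; have := xM k; rewrite big_cons/=.
    have : r * v k <= r ^+ 2 / (2 * (g + z)) + (g + z) / 2 * v k ^+ 2.
      rewrite -subr_ge0.
      have -> : r ^+ 2 / (2 * (g + z)) + (g + z) / 2 * v k ^+ 2 - r * v k =
          (r - (g + z) * v k) ^+ 2 / (2 * (g + z)).
        by field; rewrite gt_eqF.
      by rewrite divr_ge0 ?sqr_ge0// mulr_ge0// ltW.
    by lra.
  rewrite -EFinM lee_fin -[leRHS]mulrA ler_wpM2l// -expRD ler_expR.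
  rewrite -/S mulrDr addrAC lerD2l.
  by rewrite le_eqVlt; apply/orP; left; apply/eqP; rewrite /al /z; field; rewrite !gt_eqF.
have mexp : measurable_fun setT (fun r : R => (expR (al * r ^+ 2 / (2 * s ^+ 2)))%:E).
  apply/measurable_EFinP; apply: measurableT_comp => //.
  by apply: measurable_funM => //; apply: measurable_funM.
have [mG G0] := admissible_gsmooths s [seq p.1 | p <- l] aF.
apply: (@le_trans _ _ (\int[normal_prob 0 s]_r
  ((A * expR (la * M + S))%:E * (expR (al * r ^+ 2 / (2 * s ^+ 2)))%:E))%E).
  apply: ge0_le_integral => //.
  - exact: measurable_section.
  - by apply: emeasurable_funM.
rewrite ge0_integralZl//; last by rewrite lee_fin mulr_ge0// expR_ge0.
rewrite integral_normal_expR_sqr// -EFinM lee_fin.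
have -> : A * expR (la * M + (z / (2 * g) + S)) =
    A * expR (la * M + S) * expR (z / (2 * g)).
  by rewrite -mulrA -expRD; congr (_ * expR _); ring.
rewrite ler_wpM2l ?mulr_ge0 ?expR_ge0//.
(* (1 - al)^(-1/2) = (1 + z / g)^(1/2), which is at most exp(z / (2g)). *)
have -> : 1 - al = g / (g + z) by rewrite /al; field; rewrite gt_eqF.
rewrite -sqrtrV ?(divr_ge0 (ltW g0) (ltW tau0))// invf_div.
have -> : expR (z / (2 * g)) = Num.sqrt (expR (z / (2 * g)) ^+ 2).
  by rewrite sqrtr_sqr ger0_norm ?expR_ge0.
rewrite ler_wsqrtr//.
rewrite -expRM_natl (_ : 2 * _ = z / g); last by field; rewrite gt_eqF.
by apply: le_trans (expR_ge1Dx _); rewrite mulrDl divff ?gt_eqF.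
Qed.

End MomentGeneratingBound.

(** * Chevet's inequality for the soft maximum *)

Section GaussianChevet.
Context {R : realType} {K : finType}.

(* Adding the independent constant direction [fun=> 1] turns [lw] into a
   process that dominates <h, u> + <h', b> in the Slepian order; on the moment
   generating function this costs exactly the factor exp(lambda^2 / 2). *)
Lemma chevet_mgf (n m : nat) (k0 : K) (uu : K -> 'I_n -> R) (bb : K -> 'I_m -> R)
    (lw : seq (K -> R)) (s la th : R) :
  0 < s -> 0 < la -> 0 < th <= 1 ->
  (forall k, \sum_i uu k i ^+ 2 = 1) -> (forall k, \sum_i bb k i ^+ 2 = 1) ->
  (forall k j, cov lw k j = (\sum_i uu k i * uu j i) * (\sum_i bb k i * bb j i)) ->
  (gsmooths s lw (EFin \o softmax_pow (la / s / th) th) (fun=> 0%R) <=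
   (#|K|%:R `^ th *
     expR (la * (Num.sqrt n%:R + Num.sqrt m%:R) + la ^+ 2 / 2))%:E)%E.
Proof.
move=> s0 la0 /andP[th0 th1] hu hb hcov.
set be := la / s / th.
have bth : be * th = la / s by rewrite /be divfK// gt_eqF.
have be0 : 0 <= be by rewrite /be !divr_ge0// ltW.
set F := EFin \o _.
have aF : admissible F by exact: admissible_softmax_pow.
have pos0 (q : nat) (cc : K -> 'I_q -> R) : (forall k, \sum_i cc k i ^+ 2 = 1) ->
    0 < Num.sqrt (q%:R : R).
  move=> h; rewrite sqrtr_gt0 ltr0n lt0n; apply/negP => /eqP q0.
  by have := h k0; subst q; rewrite big_ord0 => /eqP; rewrite eq_sym oner_eq0.
have n0 := pos0 _ _ hu; have m0 := pos0 _ _ hb.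
have cs (q : nat) (cc : K -> 'I_q -> R) k j : (forall k, \sum_i cc k i ^+ 2 = 1) ->
    \sum_i cc k i * cc j i <= 1.
  move=> h; have : 0 <= \sum_i (cc k i - cc j i) ^+ 2.
    by apply: sumr_ge0 => i _; exact: sqr_ge0.
  have -> : \sum_i (cc k i - cc j i) ^+ 2 =
      \sum_i cc k i ^+ 2 + \sum_i cc j i ^+ 2 - 2 * \sum_i cc k i * cc j i.
    rewrite mulr_sumr -big_split -sumrB/=; apply: eq_bigr => i _; ring.
  by rewrite !h => ?; lra.
pose one : K -> R := fun=> 1.
(* The weights s sqrt(n) and s sqrt(m) minimise the bound of [gsmooths_exp_bound]: the groups
   contribute la sqrt(n) and la sqrt(m) to the exponent, half from the squares and half from the
   chi-square factors. *)
pose lbp : seq ((K -> R) * R) :=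
  [seq ((fun k => uu k i), s * Num.sqrt n%:R) | i <- index_enum 'I_n] ++
  [seq ((fun k => bb k i), s * Num.sqrt m%:R) | i <- index_enum 'I_m].
pose lb := [seq p.1 | p <- lbp].
have sum_lbp (f : (K -> R) * R -> R) : \sum_(p <- lbp) f p =
    \sum_i f ((fun k => uu k i), s * Num.sqrt n%:R) +
    \sum_i f ((fun k => bb k i), s * Num.sqrt m%:R).
  by rewrite /lbp big_cat !big_map.
have covb k j : cov lb k j = \sum_i uu k i * uu j i + \sum_i bb k i * bb j i.
  by rewrite /cov /lb big_map sum_lbp.
have cova k j : cov (one :: lw) k j =
    1 + (\sum_i uu k i * uu j i) * (\sum_i bb k i * bb j i).
  by rewrite /cov big_cons mulr1 -/(cov lw k j) hcov.
have nsq (q : nat) (cc : K -> 'I_q -> R) k : (forall k, \sum_i cc k i ^+ 2 = 1) ->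
    \sum_i cc k i * cc k i = 1.
  by move=> h; rewrite -(h k); apply: eq_bigr => i _; rewrite expr2.
(* The variances are equal, and 1 + XY - X - Y = (1 - X)(1 - Y) >= 0 because the inner products X, Y
   of unit vectors are at most 1. *)
have comp : (gsmooths s (one :: lw) F (fun=> 0%R) <= gsmooths s lb F (fun=> 0%R))%E.
  apply: slepian_kahane => //; first by rewrite ltW.
    by move=> k; rewrite cova covb !nsq// mulr1.
  move=> k j; rewrite cova covb.
  have := cs _ _ k j hu; have := cs _ _ k j hb.
  move: (\sum_i _ * _) (\sum_i _ * _) => X Y; nra.
(* A shift of all coordinates by r multiplies [F] by exp(la r / s), so noise along [one] acts as a
   scalar. *)
have oneF : gsmooth s one F = (fun x => (expR (la ^+ 2 / 2))%:E * F x)%E.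
  apply/funext => x; rewrite /gsmooth.
  transitivity (\int[normal_prob 0 s]_r (F x * (expR (la / s * r + 0))%:E))%E.
    apply: eq_integral => r _; rewrite /F/= -EFinM addr0; congr EFin.
    rewrite /softmax_pow (_ : sumexp _ _ = sumexp be x * expR (be * r)).
      by rewrite powRM ?expR_ge0 ?(ltW (sumexp_gt0 _ _ k0))// -expRM mulrAC bth.
    rewrite /sumexp mulr_suml; apply: eq_bigr => k _.
    by rewrite mulr1 mulrDr expRD.
  rewrite ge0_integralZl//; last by rewrite lee_fin powR_ge0.
    rewrite integral_normal_expR ?gt_eqF// muleC; congr (_%:E * _)%E.
    by congr expR; field; rewrite gt_eqF.
  apply/measurable_EFinP; apply: measurableT_comp => //.
  by apply: measurable_funD => //; apply: measurable_funM.
have lhs : gsmooths s (one :: lw) F (fun=> 0%R) =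
    ((expR (la ^+ 2 / 2))%:E * gsmooths s lw F (fun=> 0%R))%E.
  rewrite -[LHS]/(gsmooth s one (gsmooths s lw F) (fun=> 0%R)) gsmooth_gsmooths//.
  by rewrite oneF gsmoothsZ// lee_fin expR_ge0.
pose M := s * (Num.sqrt n%:R + Num.sqrt m%:R + 2 * la) / 2.
have zE : la / s * s ^+ 2 = la * s by field; rewrite gt_eqF.
have ub : (gsmooths s lb F (fun=> 0%R) <= (#|K|%:R `^ th *
    expR (la / s * M + \sum_(p <- lbp) la / s * s ^+ 2 / (2 * p.2)))%:E)%E.
  apply: gsmooths_exp_bound => //.
  - by rewrite divr_ge0// ltW.
  - move=> y M' yM'; rewrite /F/= lee_fin -bth.
    by apply: softmax_pow_le => //; exact: ltW.
  - by rewrite /lbp all_cat !all_map; apply/andP; split; apply/allP => i _ /=; rewrite mulr_gt0.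
  - move=> k; rewrite sum_lbp/= zE add0r -!mulr_sumr hu hb /M.
    by rewrite le_eqVlt; apply/orP; left; apply/eqP; field.
rewrite -(@lee_pmul2l _ (expR (la ^+ 2 / 2))%:E)// ?lte_fin ?expR_gt0//.
rewrite -lhs; apply: (le_trans comp); apply: (le_trans ub).
rewrite -EFinM lee_fin [leRHS]mulrCA ler_wpM2l ?powR_ge0// -expRD ler_expR.
rewrite sum_lbp/= !sumr_const !card_ord zE.
have sq (q : nat) : 0 < Num.sqrt (q%:R : R) ->
    la * s / (2 * (s * Num.sqrt q%:R)) *+ q = la * Num.sqrt q%:R / 2.
  move=> q0; rewrite -mulr_natr -[X in _ * X](@sqr_sqrtr _ q%:R) ?ler0n//.
  by field; rewrite !gt_eqF.
rewrite (sq n n0) (sq m m0) /M le_eqVlt; apply/orP; left; apply/eqP.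
by field; rewrite gt_eqF.
Qed.

End GaussianChevet.

(** * Tail bound over a finite index set *)

Section GaussianTail.
Context {d} {T : measurableType d} {R : realType}.
Variable P : probability T R.
Context {I : finType}.
Variables (s : R) (xi : I -> T -> R).
Hypothesis s0 : 0 < s.
Hypothesis mxi : forall i, measurable_fun setT (xi i).
Hypothesis indep : forall B : I -> set R, (forall i, measurable (B i)) ->
  P (\bigcap_i (xi i @^-1` B i)) = (\prod_i normal_prob 0 s (B i))%E.

(** Markov's inequality with lambda = tau, the minimiser of lambda^2 / 2 - lambda tau; letting [th]
    tend to 0 removes the power of the cardinality of [K]. *)
Lemma chevet_tail_fin (K : finType) (n m : nat) (uu : K -> 'I_n -> R)
    (bb : K -> 'I_m -> R) (a : I -> K -> R) (tau : R) : 0 < tau ->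
  (forall k, \sum_i uu k i ^+ 2 = 1) -> (forall k, \sum_i bb k i ^+ 2 = 1) ->
  (forall k j, \sum_i a i k * a i j =
     (\sum_i uu k i * uu j i) * (\sum_i bb k i * bb j i)) ->
  (P [set t | exists k, (s * (Num.sqrt n%:R + Num.sqrt m%:R + tau) <
       \sum_i xi i t * a i k)%R]
   <= (expR (- (tau ^+ 2 / 2)))%:E)%E.
Proof.
move=> tau0 hu hb ha.
set E := [set t | _]; pose c := s * (Num.sqrt n%:R + Num.sqrt m%:R + tau).
have mX k : measurable_fun setT (fun t => \sum_i xi i t * a i k).
  by apply: measurable_sum => i; exact: measurable_funM.
have mE : measurable E.
  have -> : E = \bigcup_(k in [set: K]) ((fun t => \sum_i xi i t * a i k) @^-1` `]c, +oo[%classic).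
    apply/seteqP; split => t /=; first by move=> [k ck]; exists k => //=; rewrite in_itv/= andbT.
    by move=> [k _ /=]; rewrite in_itv/= andbT => ?; exists k.
  apply: fin_bigcup_measurable; first exact: finite_finset.
  by move=> k _; rewrite -[X in measurable X]setTI; apply: mX => //; exact: measurable_itv.
case: (pselect (exists k : K, True)) => [[k0 _]|noK]; last first.
  have -> : E = set0 by apply/seteqP; split => // t [k _]; exfalso; apply: noK; exists k.
  by rewrite measure0 lee_fin expR_ge0.
have key (th : R) : 0 < th <= 1 ->
    (P E <= (#|K|%:R `^ th * expR (- (tau ^+ 2 / 2)))%:E)%E.
  move=> th01; have /andP[th0 th1] := th01.
  set be := tau / s / th.
  have bth : be * th = tau / s by rewrite /be divfK// gt_eqF.
  pose F := EFin \o softmax_pow be th : @pspace R K -> \bar R.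
  have aF : admissible F by exact: admissible_softmax_pow.
  have [mF F0] := aF.
  pose G t : @pspace R K := fun k => 0 + \sum_(i <- index_enum I) xi i t * a i k.
  have GE t k : G t k = \sum_i xi i t * a i k by rewrite /G add0r.
  have mG : measurable_fun setT G.
    apply: measurable_pspace => k.
    rewrite (_ : (fun t => _) = (fun t => \sum_i xi i t * a i k)); last first.
      by apply/funext => t; rewrite GE.
    exact: mX.
  have int : (\int[P]_t F (G t) = gsmooths s [seq a i | i <- index_enum I] F (fun=> 0%R))%E.
    transitivity (P setT * gsmooths s [seq a i | i <- index_enum I] F (fun=> 0%R))%E.
      apply: (@integral_gaussian_seq _ T R K I s a xi mxi (index_enum I) (fun=> 0) P) => //.
        exact: index_enum_uniq.
      move=> B mB; rewrite [X in (X * _)%E]probability_setT mul1e -indep//; congr (P _).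
      apply/seteqP; split => t h i /=; last by move=> _; exact: h.
      by move=> _; apply: h; rewrite /= mem_index_enum.
    by rewrite [X in (X * _)%E]probability_setT mul1e.
  have mgf := @chevet_mgf R K n m k0 uu bb [seq a i | i <- index_enum I] s tau th s0 tau0 th01 hu hb.
  have hc k j : cov [seq a i | i <- index_enum I] k j =
      (\sum_i uu k i * uu j i) * (\sum_i bb k i * bb j i).
    by rewrite /cov big_map ha.
  have {mgf}mgf := mgf hc; rewrite -/be -/F -int in mgf.
  have -> : P E = (\int[P]_t (\1_E t)%:E)%E by rewrite integral_indic// setIT.
  apply: (@le_trans _ _ (\int[P]_t ((expR (- (tau / s * c)))%:E * F (G t)))%E).
    apply: ge0_le_integral => //.
    - by apply/measurable_EFinP; exact: measurable_indic.
    - by apply: emeasurable_funM => //; exact: (measurableT_comp mF mG).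
    - move=> t _; rewrite /F/= -EFinM lee_fin indicE.
      have [|_] := boolP (t \in E); last by rewrite mulr_ge0 ?expR_ge0 ?powR_ge0.
      rewrite inE => -[k ck].
      apply: (@le_trans _ _ (expR (- (tau / s * c)) * expR (be * th * G t k))).
        rewrite -expRD -[leLHS]expR0 ler_expR bth GE addrC subr_ge0.
        by rewrite ler_wpM2l ?divr_ge0// ltW.
      by rewrite ler_wpM2l ?expR_ge0//; apply: softmax_pow_ge; exact: ltW.
  rewrite ge0_integralZl ?lee_fin ?expR_ge0//; last exact: (measurableT_comp mF mG).
  apply: (le_trans (lee_wpmul2l _ mgf)); first by rewrite lee_fin expR_ge0.
  rewrite -EFinM lee_fin mulrCA ler_wpM2l ?powR_ge0// -expRD ler_expR /c.
  by rewrite le_eqVlt; apply/orP; left; apply/eqP; field; rewrite gt_eqF.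
apply/lee_addgt0Pr => e e0.
pose L : R := ln #|K|%:R.
have K1 : 1 <= #|K|%:R :> R by rewrite ler1n; apply/card_gt0P; exists k0.
have K0 : 0 < #|K|%:R :> R by exact: lt_le_trans K1.
have L0 : 0 <= L by rewrite ln_ge0.
have l0 : 0 < ln (1 + e) by rewrite ln_gt0// ltrDl.
(* Then th L <= ln(1 + e), while [th] stays in the range that [key] accepts; [L + 1] avoids a zero
   denominator. *)
pose th := Num.min 1 (ln (1 + e) / (L + 1)).
have th0 : 0 < th by rewrite lt_min ltr01 divr_gt0// ltr_wpDl.
have th1 : th <= 1 by rewrite ge_min lexx.
apply: (le_trans (key th _)); first by rewrite th0.
rewrite -EFinD lee_fin.
have h1 : #|K|%:R `^ th <= 1 + e.
  rewrite powR_expR// -[leRHS]lnK ?posrE ?addr_gt0// ler_expR -/L.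
  have : th <= ln (1 + e) / (L + 1) by rewrite ge_min lexx orbT.
  rewrite ler_pdivlMr ?ltr_wpDl//; apply: le_trans.
  by rewrite mulrDr mulr1 lerDl ltW.
have h2 : expR (- (tau ^+ 2 / 2)) <= 1 :> R.
  by rewrite expR_le1 oppr_le0 divr_ge0// sqr_ge0.
have h3 : 0 <= expR (- (tau ^+ 2 / 2)) :> R by exact: expR_ge0.
apply: (le_trans (ler_wpM2r h3 h1)); rewrite mulrDl mul1r lerD2l.
by rewrite -[leRHS]mulr1 ler_wpM2l// ltW.
Qed.

End GaussianTail.

(** * Linear algebra and least squares *)

Section LinearAlgebraFacts.
Context {R : realType}.

Definition inner (n : nat) (u v : 'cV[R]_n) : R := \sum_i u i 0 * v i 0.

Lemma innerE n (u v : 'cV[R]_n) : inner u v = (u^T *m v) 0 0.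
Proof. by rewrite mxE; apply: eq_bigr => i _; rewrite mxE. Qed.

Lemma sqnorm2E n (v : 'cV[R]_n) : sqnorm2 v = inner v v.
Proof. by apply: eq_bigr => i _; rewrite expr2. Qed.

Lemma sqnorm2_ge0 n (v : 'cV[R]_n) : 0 <= sqnorm2 v.
Proof. by apply: sumr_ge0 => i _; exact: sqr_ge0. Qed.

Lemma sqnorm2_eq0 n (v : 'cV[R]_n) : sqnorm2 v = 0 -> v = 0.
Proof.
move=> /eqP; rewrite psumr_eq0; last by move=> i _; exact: sqr_ge0.
move=> /allP h; apply/colP => i; rewrite mxE; apply/eqP.
by have := h i (mem_index_enum _); rewrite sqrf_eq0.
Qed.

Lemma inner_mulmx n m (M : 'M[R]_(n, m)) u v : inner u (M *m v) = inner (M^T *m u) v.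
Proof. by rewrite !innerE trmx_mul trmxK mulmxA. Qed.

Lemma cauchy_schwarz n (u v : 'cV[R]_n) :
  inner u v <= Num.sqrt (sqnorm2 u) * Num.sqrt (sqnorm2 v).
Proof.
set a := Num.sqrt _; set b := Num.sqrt _.
have a2 : a ^+ 2 = sqnorm2 u by rewrite sqr_sqrtr ?sqnorm2_ge0.
have b2 : b ^+ 2 = sqnorm2 v by rewrite sqr_sqrtr ?sqnorm2_ge0.
have a0 : 0 <= a by exact: sqrtr_ge0.
have b0 : 0 <= b by exact: sqrtr_ge0.
have h : 0 <= \sum_i (b * u i 0 - a * v i 0) ^+ 2.
  by apply: sumr_ge0 => i _; exact: sqr_ge0.
have E : \sum_i (b * u i 0 - a * v i 0) ^+ 2 =
    b ^+ 2 * sqnorm2 u + a ^+ 2 * sqnorm2 v - 2 * a * b * inner u v.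
  rewrite /sqnorm2 /inner !mulr_sumr -big_split -sumrB/=.
  by apply: eq_bigr => i _; ring.
have [ab0|ab0] := eqVneq (a * b) 0.
  move/eqP: ab0; rewrite mulf_eq0 => /orP[] /eqP z0; rewrite z0 ?mul0r ?mulr0.
  - have -> : u = 0 by apply: sqnorm2_eq0; rewrite -a2 z0 expr0n.
    by rewrite /inner big1// => i _; rewrite mxE mul0r.
  - have -> : v = 0 by apply: sqnorm2_eq0; rewrite -b2 z0 expr0n.
    by rewrite /inner big1// => i _; rewrite mxE mulr0.
have abp : 0 < a * b by rewrite lt_neqAle eq_sym ab0 mulr_ge0.
have {}h : 0 <= 2 * (a * b) * (a * b - inner u v).
  by move: h; rewrite E -a2 -b2; congr (_ <= _); ring.
by move: h; rewrite pmulr_rge0 ?subr_ge0// mulr_gt0.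
Qed.

(** One step of Gram-Schmidt on the rows: removing from [Z2] its component along [z1] leaves [Z3]
    orthogonal to [z1], and induction factors the Gram matrix of [Z3]. *)
Lemma gram_cholesky (m N : nat) (Z : 'M[R]_(m, N)) :
  exists L : 'M[R]_m, Z *m Z^T = L *m L^T.
Proof.
elim: m Z => [|m ih] Z; first by exists 0; rewrite [LHS]flatmx0 [RHS]flatmx0.
rewrite -[m.+1]/(1 + m)%N in Z *.
rewrite -(vsubmxK Z); move: (usubmx Z) (dsubmx Z) => z1 Z2 {Z}.
pose a := (z1 *m z1^T) 0 0.
have aE : z1 *m z1^T = a%:M by apply/matrixP => i j; rewrite !ord1 [RHS]mxE eqxx mulr1n.
have aS : a = sqnorm2 z1^T by rewrite /a sqnorm2E innerE trmxK.
have a0 : 0 <= a by rewrite aS sqnorm2_ge0.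
(* If a = 0 then z1 = 0, and Z2 z1^T = a c still holds, so rank-deficient designs are covered. *)
pose c := a^-1 *: (Z2 *m z1^T).
have Z2z : Z2 *m z1^T = a *: c.
  have [a00|an0] := eqVneq a 0.
    have z10 : z1^T = 0 by apply: sqnorm2_eq0; rewrite -aS.
    by rewrite a00 scale0r z10 mulmx0.
  by rewrite scalerA mulfV// scale1r.
clearbody c; pose Z3 := Z2 - c *m z1.
have Z3z : Z3 *m z1^T = 0.
  by rewrite mulmxBl -mulmxA aE Z2z mul_mx_scalar subrr.
have zZ3 : z1 *m Z3^T = 0 by rewrite -[LHS]trmxK trmx_mul trmxK Z3z trmx0.
have Z2E : Z2 = Z3 + c *m z1 by rewrite subrK.
have [L LE] := ih Z3.
exists (block_mx (Num.sqrt a)%:M 0 (Num.sqrt a *: c) L).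
have sa : Num.sqrt a * Num.sqrt a = a by rewrite -expr2 sqr_sqrtr.
rewrite tr_col_mx mul_col_row tr_block_mx mulmx_block !trmx0 !mulmx0 !mul0mx !addr0.
rewrite tr_scalar_mx linearZ/= aE; congr block_mx.
- by rewrite -scalar_mxM sa.
- by rewrite -[LHS]trmxK trmx_mul trmxK Z2z mul_scalar_mx scalerA sa linearZ.
- by rewrite Z2z mul_mx_scalar scalerA sa.
- rewrite -scalemxAl -scalemxAr scalerA sa -LE {1 2}Z2E.
  rewrite linearD/= mulmxDl !mulmxDr trmx_mul.
  rewrite (mulmxA Z3) Z3z mul0mx addr0 -(mulmxA c z1 Z3^T) zZ3 mulmx0 add0r.
  rewrite addrC; congr (_ + _).
  by rewrite -mulmxA (mulmxA z1) aE mul_scalar_mx -scalemxAr.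
Qed.

Lemma mulmx_family (d : measure_display) (T : measurableType d) (n m N : nat) (X : 'I_N -> T -> 'cV[R]_n)
    (Y : 'I_N -> T -> 'cV[R]_m) t :
  family_mx X t *m (family_mx Y t)^T = \sum_l X l t *m (Y l t)^T.
Proof.
apply/matrixP => i j; rewrite summxE mxE; apply: eq_bigr => l _.
by rewrite !mxE big_ord1 !mxE.
Qed.

(** The estimator is perturbed along the left side [G] itself: the first-order change is then
    proportional to [g], the squared Frobenius norm of [G], which minimality forces to vanish. *)
Lemma least_squares_normal_eq (n p N : nat) (x : 'I_N -> 'cV[R]_n)
    (u : 'I_N -> 'cV[R]_p) (y : 'I_N -> 'cV[R]_n) (Ah : 'M[R]_n) (Bh : 'M[R]_(n, p)) :
  is_least_squares x u y Ah Bh ->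
  \sum_l (Ah *m x l + Bh *m u l - y l) *m (col_mx (x l) (u l))^T = 0.
Proof.
move=> ls; set r := fun l => Ah *m x l + Bh *m u l - y l.
set z := fun l => col_mx (x l) (u l).
rewrite -[LHS]/(\sum_l r l *m (z l)^T); set G := \sum_l _.
pose g := \sum_l inner (r l) (G *m z l).
pose h := \sum_l sqnorm2 (G *m z l).
have h0 : 0 <= h by apply: sumr_ge0 => l _; exact: sqnorm2_ge0.
have quad (e : R) : 0 <= 2 * e * g + e ^+ 2 * h.
  have := ls (Ah + e *: lsubmx G) (Bh + e *: rsubmx G).
  have E l : sqnorm2 ((Ah + e *: lsubmx G) *m x l + (Bh + e *: rsubmx G) *m u l - y l) =
      sqnorm2 (r l) + (2 * e * inner (r l) (G *m z l) + e ^+ 2 * sqnorm2 (G *m z l)).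
    have -> : (Ah + e *: lsubmx G) *m x l + (Bh + e *: rsubmx G) *m u l - y l =
        r l + e *: (G *m z l).
      have -> : G *m z l = lsubmx G *m x l + rsubmx G *m u l.
        by rewrite -{1}[G]hsubmxK mul_row_col.
      by rewrite !mulmxDl -!scalemxAl scalerDr /r [X in X - _]addrACA [LHS]addrAC.
    rewrite /sqnorm2 /inner !mulr_sumr -!big_split/=; apply: eq_bigr => i _.
    by rewrite !mxE; ring.
  rewrite (eq_bigr _ (fun l _ => E l)) big_split/= lerDl => /le_trans; apply.
  by rewrite big_split/= -!mulr_sumr.
have GE i j : G i j = \sum_l r l i 0 * z l j 0.
  by rewrite /G summxE; apply: eq_bigr => l _; rewrite mxE big_ord1 [X in _ * X]mxE.
have gE : g = \sum_i \sum_j G i j ^+ 2.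
  transitivity (\sum_i \sum_j G i j * \sum_l r l i 0 * z l j 0); last first.
    by apply: eq_bigr => i _; apply: eq_bigr => j _; rewrite -GE expr2.
  rewrite /g /inner exchange_big/=; apply: eq_bigr => i _.
  under eq_bigr => l _ do rewrite [X in _ * X]mxE mulr_sumr.
  rewrite exchange_big/=; apply: eq_bigr => j _.
  by rewrite mulr_sumr; apply: eq_bigr => l _; rewrite mulrCA.
have g0 : 0 <= g.
  by rewrite gE; apply: sumr_ge0 => i _; apply: sumr_ge0 => j _; exact: sqr_ge0.
have gz : g = 0.
  have h1 : 0 < h + 1 by rewrite ltr_wpDl.
  (* This choice makes the quadratic equal to -g^2 (h + 2) / (h + 1)^2; [h + 1] is positive even
     when h = 0. *)
  have := quad (- (g / (h + 1))).
  have -> : 2 * - (g / (h + 1)) * g + (- (g / (h + 1))) ^+ 2 * h =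
      - (g ^+ 2 * ((h + 2) / (h + 1) ^+ 2)) by field; rewrite gt_eqF.
  rewrite oppr_ge0 pmulr_lle0; last by rewrite divr_gt0 ?exprn_gt0// ltr_wpDl.
  by rewrite le_eqVlt ltNge sqr_ge0 orbF sqrf_eq0 => /eqP.
apply/matrixP => i j; rewrite [RHS]mxE; apply/eqP.
move: gz; rewrite gE => /eqP; rewrite psumr_eq0; last first.
  by move=> k _; apply: sumr_ge0 => k' _; exact: sqr_ge0.
move=> /allP /(_ i (mem_index_enum _)); rewrite psumr_eq0; last first.
  by move=> k _; exact: sqr_ge0.
by move=> /allP /(_ j (mem_index_enum _)); rewrite sqrf_eq0.
Qed.

Lemma quad_form_gram (n m : nat) (X : 'M[R]_(m, n)) (v : 'cV[R]_n) :
  quad_form (X^T *m X) v = sqnorm2 (X *m v).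
Proof. by rewrite /quad_form sqnorm2E innerE trmx_mul !mulmxA. Qed.

(** At v = M a the pseudoinverse form is a^T M a = |Z^T a|^2, and off the range the right side is
    infinite because c > 0. *)
Lemma loewner_scaled_inv_gramP (n m N : nat) (D : 'M[R]_(n, m)) (c : R)
    (Z : 'M[R]_(m, N)) : 0 < c ->
  loewner_le_scaled_inv (D^T *m D) c (Z *m Z^T) <->
  forall a : 'cV[R]_m, sqnorm2 (D *m (Z *m Z^T) *m a) <= c * sqnorm2 (Z^T *m a).
Proof.
move=> c0; set M := Z *m Z^T.
have [MXM _ _ _] := pseudoinverseP M.
have MT : M^T = M by rewrite /M trmx_mul trmxK.
have E a : inv_quad_form M (M *m a) = (sqnorm2 (Z^T *m a))%:E.
  rewrite /inv_quad_form; case: asboolP => [_|]; last by case; exists a.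
  rewrite -quad_form_gram trmxK -/M /quad_form trmx_mul MT.
  have -> : a^T *m M *m pseudoinverse M *m (M *m a) =
      a^T *m (M *m pseudoinverse M *m M) *m a by rewrite !mulmxA.
  by rewrite MXM.
split => h a.
  have := h (M *m a); rewrite E quad_form_gram -EFinM lee_fin.
  by rewrite mulmxA.
rewrite quad_form_gram /inv_quad_form; case: asboolP => [[b ab]|_].
  have := h b; rewrite -lee_fin EFinM -E ab mulmxA.
  by rewrite /inv_quad_form; case: asboolP => // -[]; exists b.
by rewrite gt0_muley ?lte_fin// leey.
Qed.

End LinearAlgebraFacts.

(** * Fixed design *)

Section CountableReduction.
Context {R : realType}.

Lemma continuous_bigsum (U : topologicalType) (I : Type) (r : seq I) (f : I -> U -> R) :
  (forall i, continuous (f i)) -> continuous (fun x => \sum_(i <- r) f i x).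
Proof.
move=> cf x; elim: r => [|i r ih].
  by under eq_fun do rewrite big_nil; exact: cvg_cst.
under eq_fun do rewrite big_cons.
by apply: cvgD => //; exact: cf.
Qed.

Lemma continuous_mulr (U : topologicalType) (f g : U -> R) :
  continuous f -> continuous g -> continuous (fun x => f x * g x).
Proof. by move=> cf cg x; apply: cvgM; [exact: cf|exact: cg]. Qed.

Lemma continuous_subr (U : topologicalType) (f g : U -> R) :
  continuous f -> continuous g -> continuous (fun x => f x - g x).
Proof. by move=> cf cg x; apply: cvgB; [exact: cf|exact: cg]. Qed.

Lemma continuous_mulmx_coord n m (M : 'M[R]_(n, m)) i :
  continuous (fun v : 'cV[R]_m => (M *m v) i 0).
Proof.
under eq_fun do rewrite mxE.
apply: continuous_bigsum => j; apply: continuous_mulr => //; last exact: coord_continuous.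
exact: cst_continuous.
Qed.

Lemma continuous_inner_mulmx n m (u : 'cV[R]_n) (M : 'M[R]_(n, m)) :
  continuous (fun v : 'cV[R]_m => inner u (M *m v)).
Proof.
apply: continuous_bigsum => i; apply: continuous_mulr; last exact: continuous_mulmx_coord.
exact: cst_continuous.
Qed.

Lemma continuous_norm_mulmx n m (M : 'M[R]_(n, m)) :
  continuous (fun v : 'cV[R]_m => Num.sqrt (sqnorm2 (M *m v))).
Proof.
move=> v.
apply: (@continuous_comp _ _ _ (fun v : 'cV[R]_m => sqnorm2 (M *m v)) Num.sqrt).
  apply: continuous_bigsum => i; under eq_fun do rewrite expr2.
  by apply: continuous_mulr; exact: continuous_mulmx_coord.
exact: sqrt_continuous.
Qed.

(** The set where f > 0 is open, and rational vectors are dense. *)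
Lemma rational_witness n (f : 'cV[R]_n -> R) a : continuous f -> 0 < f a ->
  exists q : 'cV[rat]_n, 0 < f (map_mx ratr q).
Proof.
move=> cf fa.
have /nbhs_ballP[e /= e0 he] : \forall x \near a, 0 < f x by exact: (cvgr_gt (f a) (cf a)).
have hq i : exists q : rat, ratr q \in `](a i 0 - e), (a i 0 + e)[.
  by apply: rat_in_itvoo; rewrite ltrBlDr -addrA ltrDl addr_gt0.
exists (\col_i xchoose (hq i)); apply: he; split => // i j.
rewrite !mxE ord1 /ball/= distrC ltr_distl.
by have := xchooseP (hq i); rewrite in_itv.
Qed.

(** Positivity is invariant under positive rescaling of [u] and of [a], so rational vectors can be
    used without normalising them. *)
Definition gap {n m N : nat} (kap : R) (Z : 'M[R]_(m, N)) (W : 'M[R]_(n, N))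
    (u : 'cV[R]_n) (a : 'cV[R]_m) : R :=
  inner u (W *m (Z^T *m a)) -
  kap * Num.sqrt (sqnorm2 u) * Num.sqrt (sqnorm2 (Z^T *m a)).

(** An enumeration of the rational pairs; an index that codes no pair gives [(0, 0)], where [gap] is
    0. *)
Definition rat_pair (n m k : nat) : 'cV[R]_n * 'cV[R]_m :=
  let q := odflt (0, 0) (@unpickle ('cV[rat]_n * 'cV[rat]_m)%type k) in
  (map_mx ratr q.1, map_mx ratr q.2).

(** This turns an uncountable union of events into a countable one. Forward, u = W Z^T a attains
    equality in Cauchy-Schwarz, and [a], then [u], is made rational, so continuity in each variable
    separately suffices; backward is Cauchy-Schwarz. *)
Lemma exceed_rat_pairP n m N (kap : R) (Z : 'M[R]_(m, N)) (W : 'M[R]_(n, N)) : 0 <= kap ->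
  (exists a, kap ^+ 2 * sqnorm2 (Z^T *m a) < sqnorm2 (W *m Z^T *m a)) <->
  (exists k, 0 < gap kap Z W (rat_pair n m k).1 (rat_pair n m k).2).
Proof.
move=> kap0; split => [[a ha]|[k]].
  pose u := W *m Z^T *m a.
  have u0 : 0 < sqnorm2 u.
    by apply: le_lt_trans ha; rewrite mulr_ge0 ?sqr_ge0 ?sqnorm2_ge0.
  have gu : 0 < gap kap Z W u a.
    rewrite /gap mulmxA -sqnorm2E subr_gt0 -[ltRHS]sqr_sqrtr ?sqnorm2_ge0// expr2.
    rewrite mulrAC ltr_pM2r ?sqrtr_gt0//.
    rewrite -[kap]ger0_norm// -sqrtr_sqr -sqrtrM ?sqr_ge0//.
    by rewrite ltr_sqrt.
  have cg : continuous (gap kap Z W u).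
    apply: continuous_subr.
      by under eq_fun do rewrite mulmxA; exact: continuous_inner_mulmx.
    apply: continuous_mulr; last exact: continuous_norm_mulmx.
    exact: cst_continuous.
  have [qa {}gu] := rational_witness cg gu.
  have {}cg : continuous (fun v => gap kap Z W v (map_mx ratr qa)).
    apply: continuous_subr.
      apply: continuous_bigsum => i.
      by apply: continuous_mulr; [exact: coord_continuous|exact: cst_continuous].
    apply: continuous_mulr; last exact: cst_continuous.
    apply: continuous_mulr; first exact: cst_continuous.
    by have := @continuous_norm_mulmx n n 1%:M; under eq_fun do rewrite mul1mx.
  have [qu {}gu] := rational_witness cg gu.
  exists (pickle (qu, qa)).
  by rewrite /rat_pair pickleK.
set u := _.1; set a := _.2 => g0; exists a.
have : kap * Num.sqrt (sqnorm2 u) * Num.sqrt (sqnorm2 (Z^T *m a)) <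
    Num.sqrt (sqnorm2 u) * Num.sqrt (sqnorm2 (W *m Z^T *m a)).
  by apply: lt_le_trans (cauchy_schwarz _ _); rewrite -subr_gt0 -mulmxA.
rewrite (mulrC kap) -mulrA => h.
have u0 : 0 < Num.sqrt (sqnorm2 u).
  rewrite lt_neqAle sqrtr_ge0 andbT eq_sym; apply/eqP => u0.
  by move: h; rewrite u0 !mul0r ltxx.
move: h; rewrite ltr_pM2l// => h.
rewrite -[ltRHS]sqr_sqrtr ?sqnorm2_ge0// -[in ltLHS](@sqr_sqrtr _ (sqnorm2 (Z^T *m a))) ?sqnorm2_ge0//.
by rewrite -exprMn !expr2 ltr_pM// mulr_ge0// sqrtr_ge0.
Qed.

End CountableReduction.

Section GaussianMatrixTail.
Context {d} {T : measurableType d} {R : realType}.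
Variable P : probability T R.
Variables (n N : nat) (s : R) (xi : 'I_n * 'I_N -> T -> R).
Hypothesis s0 : 0 < s.
Hypothesis mxi : forall i, measurable_fun setT (xi i).
Hypothesis indep : forall B : 'I_n * 'I_N -> set R, (forall i, measurable (B i)) ->
  P (\bigcap_i (xi i @^-1` B i)) = (\prod_i normal_prob 0 s (B i))%E.

Let W t : 'M[R]_(n, N) := \matrix_(i, l) xi (i, l) t.

Lemma measurable_gap m kap (Z : 'M[R]_(m, N)) u a :
  measurable_fun setT (fun t => gap kap Z (W t) u a).
Proof.
apply: measurable_funB => //; apply: measurable_sum => i.
apply: measurable_funM => //.
rewrite (_ : (fun t => _) = (fun t => \sum_l xi (i, l) t * (Z^T *m a) l 0)).
  by apply: measurable_sum => l; exact: measurable_funM.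
by apply/funext => t; rewrite mxE; apply: eq_bigr => l _; rewrite mxE.
Qed.

Lemma gaussian_matrix_tail m (Z : 'M[R]_(m, N)) (tau : R) : 0 < tau ->
  (P [set t | exists k, (0 < gap (s * (Num.sqrt n%:R + Num.sqrt m%:R + tau)) Z (W t)
      (rat_pair n m k).1 (rat_pair n m k).2)%R]
   <= (expR (- (tau ^+ 2 / 2)))%:E)%E.
Proof.
move=> tau0; set kap := s * _.
have kap0 : 0 < kap by rewrite mulr_gt0// ltr_wpDl// addr_ge0// sqrtr_ge0.
pose u k := (rat_pair n m k).1 : 'cV[R]_n; pose a k := (rat_pair n m k).2 : 'cV[R]_m.
pose E k := [set t | exists2 j, (j < k)%N & 0 < gap kap Z (W t) (u j) (a j)].
have mE k : measurable (E k).
  have -> : E k = \bigcup_(j in `I_k)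
      ((fun t => gap kap Z (W t) (u j) (a j)) @^-1` `]0, +oo[%classic).
    apply/seteqP; split => t /=; move=> [j jk g0]; exists j => //.
      by rewrite /= in_itv/= g0.
    by move: g0; rewrite /= in_itv/= andbT.
  apply: fin_bigcup_measurable; first exact: finite_II.
  move=> j _; rewrite -[X in measurable X]setTI; apply: measurable_gap => //.
have -> : [set t | exists k, 0 < gap kap Z (W t) (rat_pair n m k).1 (rat_pair n m k).2] =
    \bigcup_k E k.
  apply/seteqP; split => t /=; first by move=> [k g0]; exists k.+1 => //; exists k.
  by move=> [k _ [j _ g0]]; exists j.
(* The events [E k] increase, so by continuity from below it is enough to bound each of them, and
   each involves finitely many pairs. *)
have cvg : (P \o E) x @[x --> \oo] --> P (\bigcup_n E n).
  apply: nondecreasing_cvg_mu => //; first exact: bigcup_measurable.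
  move=> i j ij; apply/subsetPset => t [k ki g0]; exists k => //.
  exact: leq_trans ki ij.
rewrite -(cvg_lim _ cvg)//; apply: lime_le; first by apply: cvgP cvg.
apply: nearW => k /=.
(* The vectors L^T a have the same inner products as the vectors Z^T a but live in dimension m, so
   sqrt(m) appears instead of sqrt(N). *)
have [L LE] := gram_cholesky Z.
pose q j := Z^T *m a j.
pose b j := L^T *m a j.
have qb i j : inner (q i) (q j) = inner (b i) (b j).
  by rewrite /q /b !inner_mulmx !trmxK !mulmxA LE.
pose nu j := Num.sqrt (sqnorm2 (u j)); pose nq j := Num.sqrt (sqnorm2 (q j)).
(* Only pairs with both norms positive can be normalised; on the others the gap is never
   positive. *)
pose valid (j : 'I_k) := (0 < nu j) && (0 < nq j).
pose K : finType := {j : 'I_k | valid j}.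
pose ix (j : K) : nat := val (val j).
have nuK (j : K) : 0 < nu (ix j) by have /andP[] := valP j.
have nqK (j : K) : 0 < nq (ix j) by have /andP[] := valP j.
have nu2 j : nu j ^+ 2 = sqnorm2 (u j) by rewrite sqr_sqrtr// sqnorm2_ge0.
have nq2 j : nq j ^+ 2 = sqnorm2 (q j) by rewrite sqr_sqrtr// sqnorm2_ge0.
pose uu (j : K) i := u (ix j) i 0 / nu (ix j).
pose qq (j : K) l := q (ix j) l 0 / nq (ix j).
pose bb (j : K) i := b (ix j) i 0 / nq (ix j).
have innerN (n' : nat) (v v' : 'cV[R]_n') (c c' : R) :
    \sum_i (v i 0 / c) * (v' i 0 / c') = inner v v' / (c * c').
  by rewrite /inner mulr_suml; apply: eq_bigr => i _; rewrite invfM; ring.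
have hu j : \sum_i uu j i ^+ 2 = 1.
  under eq_bigr do rewrite expr2.
  by rewrite innerN -sqnorm2E -nu2 -expr2 divff// expf_neq0// gt_eqF.
have hb j : \sum_i bb j i ^+ 2 = 1.
  under eq_bigr do rewrite expr2.
  by rewrite innerN -qb -sqnorm2E -nq2 -expr2 divff// expf_neq0// gt_eqF.
(* These are the entries of the rank-one matrix u q^T: pairing it with W gives u^T W q, and inner
   products of such matrices factor. *)
pose aa (il : 'I_n * 'I_N) (j : K) := uu j il.1 * qq j il.2.
have haa k' j : \sum_il aa il k' * aa il j =
    (\sum_i uu k' i * uu j i) * (\sum_i bb k' i * bb j i).
  rewrite [X in _ * X]innerN -qb -innerN mulr_suml.
  rewrite (eq_bigr (fun il => (uu k' il.1 * uu j il.1) * (qq k' il.2 * qq j il.2))); last first.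
    by move=> il _; rewrite /aa; ring.
  rewrite -(pair_bigA _ (fun i l => (uu k' i * uu j i) * (qq k' l * qq j l)))/=.
  by apply: eq_bigr => i _; rewrite mulr_sumr.
have := chevet_tail_fin s0 mxi indep tau0 hu hb haa.
rewrite -/kap; apply: le_trans; apply: le_measure; rewrite ?inE//.
  rewrite (_ : [set t | _] = \bigcup_(j in [set: K])
      ((fun t => \sum_i xi i t * aa i j) @^-1` `]kap, +oo[%classic)).
    apply: fin_bigcup_measurable; first exact: finite_finset.
    move=> j _; rewrite -[X in measurable X]setTI.
    apply: measurable_sum => // i; exact: measurable_funM.
  apply/seteqP; split => t /=; first by move=> [j ck]; exists j => //=; rewrite in_itv/= andbT.
  by move=> [j _ /=]; rewrite in_itv/= andbT => ?; exists j.
move=> t [j jk g0].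
have h : kap * nu j * nq j < inner (u j) (W t *m q j) by rewrite -subr_gt0.
have vj : valid (Ordinal jk).
  apply/andP; split; rewrite /= lt_neqAle sqrtr_ge0 andbT eq_sym; apply/eqP => z0;
    move: h; rewrite z0 ?mulr0 ?mul0r.
  - have -> : u j = 0 by apply: sqnorm2_eq0; rewrite -nu2 z0 expr0n.
    by rewrite /inner big1 ?ltxx// => i _; rewrite mxE mul0r.
  - have -> : q j = 0 by apply: sqnorm2_eq0; rewrite -nq2 z0 expr0n.
    by rewrite mulmx0 /inner big1 ?ltxx// => i _; rewrite [X in _ * X]mxE mulr0.
exists (Sub (Ordinal jk) vj : K) => /=.
have WE i l : W t i l = xi (i, l) t by rewrite mxE.
have -> : \sum_i xi i t * aa i (Sub (Ordinal jk) vj : K) =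
    inner (u j) (W t *m q j) / (nu j * nq j).
  rewrite /inner mulr_suml.
  rewrite (eq_bigr (fun i => \sum_l u j i 0 * (xi (i, l) t * q j l 0) / (nu j * nq j))); last first.
    move=> i _; rewrite [X in _ * X / _]mxE mulr_sumr mulr_suml.
    by apply: eq_bigr => l _; rewrite WE.
  rewrite (pair_bigA _ (fun i l => u j i 0 * (xi (i, l) t * q j l 0) / (nu j * nq j)))/=.
  apply: eq_bigr => -[i l] _; by rewrite /aa /uu /qq /ix/= invfM; ring.
have /andP[p1 p2] := vj.
by rewrite ltr_pdivlMr ?mulr_gt0// mulrA.
Qed.

End GaussianMatrixTail.

(** * Random design *)

Section BorelFacts.
Context {R : realType}.

Lemma borel_preimage_continuous (U : ptopologicalType) (f : U -> R) (B : set R) :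
  continuous f -> measurable B -> borel (f @^-1` B).
Proof.
move=> cf mB.
pose UB := g_sigma_algebraType [set A : set U | open A].
have mf : measurable_fun setT (f : UB -> R).
  apply: (measurability _ (RGenOInfty.measurableE R)) => //= _ [_ [a ->] <-].
  rewrite setTI; apply: sub_sigma_algebra => /=.
  by apply: open_comp => //; exact: open_gt.
by have := mf measurableT B mB; rewrite setTI.
Qed.

(** Connects the coordinate sigma-algebra used for integration with the topological one in which
    independence is assumed. *)
Lemma borel_preimage_pspace (n m : nat) (A : set (@pspace R ('I_n * 'I_m)%type)) :
  measurable A -> borel ((fun M : 'M[R]_(n, m) => (fun i => M i.1 i.2)) @^-1` A).
Proof.
move=> mA.
pose UB := g_sigma_algebraType [set A : set 'M[R]_(n, m) | open A].
pose f (M : UB) : @pspace R ('I_n * 'I_m)%type := fun i => (M : 'M[R]_(n, m)) i.1 i.2.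
have mf : measurable_fun setT f.
  apply: measurable_pspace => i _ B mB; rewrite setTI.
  exact: (borel_preimage_continuous (@coord_continuous _ _ _ i.1 i.2)).
by have := mf measurableT A mA; rewrite setTI.
Qed.

Lemma borel_bigcap (U : ptopologicalType) (I : finType) (F : I -> set U) :
  (forall i, borel (F i)) -> borel (\bigcap_i F i).
Proof.
move=> bF; pose UB := g_sigma_algebraType [set A : set U | open A].
apply: (@fin_bigcap_measurable _ UB I setT F); first exact: finite_finset.
by move=> i _; exact: bF.
Qed.

End BorelFacts.

Section Randomness.
Context {d} {T : measurableType d} {R : realType}.

Lemma random_element_coord n m (X : T -> 'M[R]_(n, m)) i j :
  random_element X -> measurable_fun setT (fun t => X t i j).
Proof.
move=> hX _ B mB; rewrite setTI.
exact: (hX _ (borel_preimage_continuous (@coord_continuous _ _ _ i j) mB)).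
Qed.

Variable P : probability T R.

(** A box event splits into one event per sample by independence across samples, and each of these
    into entries by independence within [w l]. *)
Lemma gaussian_noise_entries (n N : nat) (s : R) (w : 'I_N -> T -> 'cV[R]_n) :
  mutually_independent P w -> (forall l, isotropic_gaussian P s (w l)) ->
  forall B : 'I_n * 'I_N -> set R, (forall i, measurable (B i)) ->
  P (\bigcap_i ((fun t => w i.2 t i.1 0) @^-1` B i)) = (\prod_i normal_prob 0 s (B i))%E.
Proof.
move=> iw gw B mB.
have bB i : borel (B i).
  by apply: (@borel_preimage_continuous R R idfun (B i)) => // x; exact: cvg_id.
pose A l : set 'cV[R]_n := \bigcap_i ((fun v : 'cV[R]_n => v i 0) @^-1` B (i, l)).
have bA l : borel (A l).
  apply: borel_bigcap => i; apply: borel_preimage_continuous => //.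
  exact: coord_continuous.
have -> : \bigcap_i ((fun t => w i.2 t i.1 0) @^-1` B i) =
    \bigcap_(l in [set` [set: 'I_N]%SET]) (w l @^-1` A l).
  apply/seteqP; split => t h.
    by move=> l _ i _; exact: (h (i, l)).
  by move=> [i l] _; apply: (h l _ i) => //=; rewrite finset.in_setT.
rewrite iw; last by move=> l _; exact: bA.
have -> : (\prod_i normal_prob 0 s (B i) =
    \prod_l \prod_i normal_prob 0 s (B (i, l)))%E.
  by rewrite exchange_big pair_bigA/=; apply: eq_bigr => -[].
apply: eq_big => l; first by rewrite finset.in_setT.
move=> _; have [nw mw] := gw l.
have -> : w l @^-1` A l =
    \bigcap_(i in [set` [set: 'I_n]%SET]) ((fun t => w l t i 0) @^-1` B (i, l)).
  apply/seteqP; split => t h i _; first exact: h.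
  by apply: (h i) => /=; rewrite finset.in_setT.
rewrite (mw [set: 'I_n]%SET (fun i => B (i, l)))//.
apply: eq_big => i; first by rewrite finset.in_setT.
by move=> _; rewrite nw.
Qed.

End Randomness.

Theorem proposition2p4
  (d : measure_display) (T : measurableType d) (R : realType)
  (P : probability T R) (n p N : nat)
  (A : 'M[R]_n) (B : 'M[R]_(n, p)) (sigma_w delta : R)
  (y x w : 'I_N -> T -> 'cV[R]_n) (u : 'I_N -> T -> 'cV[R]_p)
  (Ahat : T -> 'M[R]_n) (Bhat : T -> 'M[R]_(n, p))
  (hsigma : 0 < sigma_w) (hdelta0 : 0 < delta) (hdelta1 : delta < 1)
  (hx : forall l, random_element (x l))
  (hu : forall l, random_element (u l))
  (hw : forall l, random_element (w l))
  (hy : forall l t, y l t = A *m x l t + B *m u l t + w l t)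
  (hsamples : mutually_independent P
     (fun l t => col_mx (y l t) (col_mx (x l t) (u l t))))
  (hw_indep : mutually_independent P w)
  (hw_gauss : forall l, isotropic_gaussian P sigma_w (w l))
  (hw_xu : independent_pair P (family_mx w)
     (family_mx (fun l t => col_mx (x l t) (u l t))))
  (hN : (n + p <= N)%N)
  (hols : forall t, is_least_squares (fun l => x l t) (fun l => u l t)
     (fun l => y l t) (Ahat t) (Bhat t)) :
  holds_with_prob_ge P (1 - delta)
    [set t | loewner_le_scaled_inv
       (col_mx (Ahat t - A)^T (Bhat t - B)^T *m row_mx (Ahat t - A) (Bhat t - B))
       (sigma_w ^+ 2 *
          (Num.sqrt (n + p)%:R + Num.sqrt n%:R + Num.sqrt (2 * ln (1 / delta))) ^+ 2)
       (\sum_(l < N) col_mx (x l t) (u l t) *m row_mx (x l t)^T (u l t)^T)].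
Proof.
pose tau : R := Num.sqrt (2 * ln (1 / delta)).
have ln0 : 0 < ln (1 / delta) by rewrite ln_gt0// ltr_pdivlMr// mul1r.
have tau0 : 0 < tau by rewrite sqrtr_gt0 mulr_gt0.
(* [tau] is chosen so that the Gaussian tail equals [delta] exactly. *)
have tau2 : expR (- (tau ^+ 2 / 2)) = delta.
  rewrite sqr_sqrtr ?mulr_ge0 ?(ltW ln0)// mulrAC divff ?mul1r//.
  by rewrite lnV ?posrE// opprK lnK ?posrE.
pose kap := sigma_w * (Num.sqrt n%:R + Num.sqrt (n + p)%:R + tau).
have kap0 : 0 < kap by rewrite mulr_gt0// ltr_wpDl// addr_ge0// sqrtr_ge0.
have -> : sigma_w ^+ 2 *
    (Num.sqrt (n + p)%:R + Num.sqrt n%:R + Num.sqrt (2 * ln (1 / delta))) ^+ 2 = kap ^+ 2.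
  by rewrite -exprMn (addrC (Num.sqrt (n + p)%:R)).
pose z := fun l t => col_mx (x l t) (u l t).
pose W := family_mx w; pose Z := family_mx z.
pose I := ('I_n * 'I_N)%type; pose J := ('I_(n + p) * 'I_N)%type.
pose fW t : @pspace R I := fun i => W t i.1 i.2.
pose fZ t : @pspace R J := fun j => Z t j.1 j.2.
pose mW (v : @pspace R I) : 'M[R]_(n, N) := \matrix_(i, l) v (i, l).
pose mZ (v : @pspace R J) : 'M[R]_(n + p, N) := \matrix_(i, l) v (i, l).
have mWK t : mW (fW t) = W t by apply/matrixP => i l; rewrite mxE.
have mZK t : mZ (fZ t) = Z t by apply/matrixP => i l; rewrite mxE.
have mfW : measurable_fun setT fW.
  apply: measurable_pspace => -[i l]; rewrite /fW/=.
  by under eq_fun do rewrite mxE; exact: random_element_coord.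
have mfZ : measurable_fun setT fZ.
  apply: measurable_pspace => -[j l]; rewrite /fZ/=.
  under eq_fun do rewrite mxE.
  case: (split_ordP j) => k -> /=.
    by under eq_fun do rewrite col_mxEu; exact: random_element_coord.
  by under eq_fun do rewrite col_mxEd; exact: random_element_coord.
pose rp k := rat_pair n (n + p) k : 'cV[R]_n * 'cV[R]_(n + p).
pose bad (vz : @pspace R J) (vw : @pspace R I) := exists k,
  0 < gap kap (mZ vz) (mW vw) (rp k).1 (rp k).2.
(* Tonelli requires joint measurability in design and noise; the countable union over rational pairs
   provides it. *)
have mbad : measurable [set v : @pspace R J * @pspace R I | bad v.1 v.2].
  have -> : [set v : @pspace R J * @pspace R I | bad v.1 v.2] = \bigcup_k
      ((fun v => gap kap (mZ v.1) (mW v.2) (rp k).1 (rp k).2) @^-1` `]0, +oo[%classic).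
    apply/seteqP; split => v /=; first by move=> [k g0]; exists k => //=; rewrite in_itv/= andbT.
    by move=> [k _ /=]; rewrite in_itv/= andbT => ?; exists k.
  apply: bigcupT_measurable => k; rewrite -[X in measurable X]setTI.
  set a := (rp k).2; set b := (rp k).1.
  pose q (v : @pspace R J * @pspace R I) l : R := \sum_j v.1 (j, l) * a j 0.
  have mq l : measurable_fun setT (q ^~ l).
    apply: measurable_sum => j; apply: measurable_funM => //.
    exact: (measurableT_comp (measurable_coord (j, l))).
  have qE v l : ((mZ v.1)^T *m a) l 0 = q v l.
    by rewrite mxE; apply: eq_bigr => j _; rewrite !mxE.
  have mg : measurable_fun setT (fun v : @pspace R J * @pspace R I =>
      gap kap (mZ v.1) (mW v.2) b a).
    rewrite [X in measurable_fun _ X](_ : _ = fun v : @pspace R J * @pspace R I =>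
        \sum_i b i 0 * (\sum_l v.2 (i, l) * q v l) -
        kap * Num.sqrt (sqnorm2 b) * Num.sqrt (\sum_l q v l ^+ 2)); last first.
      apply/funext => v; rewrite /gap /inner; congr (_ - _ * Num.sqrt _).
        apply: eq_bigr => i _; rewrite [X in _ * X = _]mxE; congr (_ * _).
        by apply: eq_bigr => l _; rewrite qE [X in X * _ = _]mxE.
      by apply: eq_bigr => l _; rewrite qE.
    apply: measurable_funB.
      apply: measurable_sum => i; apply: measurable_funM => //.
      apply: measurable_sum => l; apply: measurable_funM; last exact: mq.
      exact: (measurableT_comp (measurable_coord (i, l))).
    apply: measurable_funM => //.
    apply: (measurableT_comp (continuous_measurable_fun (@sqrt_continuous R))).
    by apply: measurable_sum => i; apply: measurable_funX.
  by apply: mg => //; exact: measurable_itv.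
have badP t : bad (fZ t) (fW t) <->
    exists a, kap ^+ 2 * sqnorm2 ((Z t)^T *m a) < sqnorm2 (W t *m (Z t)^T *m a).
  by rewrite exceed_rat_pairP ?(ltW kap0)// /bad mZK mWK.
(* By [hy] the residual is the estimation error applied to [z], minus the noise [w]. *)
have normal_eq t : row_mx (Ahat t - A) (Bhat t - B) *m (Z t *m (Z t)^T) = W t *m (Z t)^T.
  rewrite !mulmx_family mulmx_sumr; apply/eqP; rewrite -subr_eq0 -sumrB; apply/eqP.
  rewrite -[RHS](least_squares_normal_eq (hols t)); apply: eq_bigr => l _.
  rewrite mulmxA -mulmxBl; congr (_ *m _).
  by rewrite /z mul_row_col !mulmxBl hy [X in X - _]addrACA !opprD !addrA.
set E := [set t | _].
pose badE := [set t | bad (fZ t) (fW t)].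
(* The complement is exact, so the measurability of [E] follows along with its probability. *)
have EE : E = ~` badE.
  apply/seteqP; split => t; rewrite /E /badE/= badP.
    rewrite (_ : \sum_l _ = Z t *m (Z t)^T); last first.
      by rewrite mulmx_family; apply: eq_bigr => l _; rewrite /z tr_col_mx.
    rewrite -tr_row_mx loewner_scaled_inv_gramP ?exprn_gt0// => h [a].
    by have := h a; rewrite normal_eq leNgt => /negP.
  rewrite (_ : \sum_l _ = Z t *m (Z t)^T); last first.
    by rewrite mulmx_family; apply: eq_bigr => l _; rewrite /z tr_col_mx.
  move=> h; rewrite -tr_row_mx loewner_scaled_inv_gramP ?exprn_gt0// => a.
  by rewrite normal_eq leNgt; apply/negP => ha; apply: h; exists a.
have mbadE : measurable badE.
  have mZW : measurable_fun setT (fun t => (fZ t, fW t)) by exact: measurable_fun_pair.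
  by have := mZW measurableT _ mbad; rewrite setTI.
(* Independence replaces the joint law of design and noise by a product; [tail] bounds the inner
   integral for every frozen design, hence also its average. *)
have Pbad : (P badE <= delta%:E)%E.
  pose h (vz : @pspace R J) (vw : @pspace R I) : \bar R :=
    (\1_[set v : @pspace R J * @pspace R I | bad v.1 v.2] (vz, vw))%:E.
  have mh : measurable_fun setT (fun v : @pspace R J * @pspace R I => h v.1 v.2).
    apply/measurable_EFinP.
    rewrite (_ : (fun v => _) = \1_[set v : @pspace R J * @pspace R I | bad v.1 v.2]).
      exact: measurable_indic.
    by apply/funext => -[].
  have h0 vz vw : (0 <= h vz vw)%E by rewrite lee_fin.
  have ind (f : T -> @pspace R J) : measurable_fun setT f ->
      (\int[P]_t h (f t) (fW t) = P [set t | bad (f t) (fW t)])%E.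
    move=> mf; have mfg : measurable_fun setT (fun t => (f t, fW t)).
      exact: measurable_fun_pair.
    have mb : measurable [set t | bad (f t) (fW t)].
      by have := mfg measurableT _ mbad; rewrite setTI.
    transitivity (\int[P]_t (\1_[set t | bad (f t) (fW t)] t)%:E)%E; first by [].
    by rewrite integral_indic// setIT.
  have mxi (i : I) : measurable_fun setT (fun t => w i.2 t i.1 0).
    exact: random_element_coord.
  have tail vz : (P [set t | bad vz (fW t)] <= delta%:E)%E.
    have := gaussian_matrix_tail hsigma mxi (gaussian_noise_entries hw_indep hw_gauss)
      (mZ vz) tau0.
    rewrite tau2; apply: le_trans; rewrite le_eqVlt; apply/orP; left; apply/eqP.
    have WE t : mW (fW t) = \matrix_(i, l) w l t i 0 by rewrite mWK.
    by congr (P _); apply/seteqP; split => t [k g0]; exists k; move: g0; rewrite WE.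
  have fg (U : set (@pspace R J)) (V : set (@pspace R I)) : measurable U -> measurable V ->
      P (fZ @^-1` U `&` fW @^-1` V) = (P (fZ @^-1` U) * image_measure P mfW V)%E.
    move=> mU mV; rewrite setIC [RHS]muleC.
    exact: (hw_xu _ _ (borel_preimage_pspace mV) (borel_preimage_pspace mU)).
  rewrite /badE -(ind fZ mfZ).
  rewrite (integral_independent_pair mfZ mfW fg mh h0).
  apply: (@le_trans _ _ (\int[P]_t (cst delta%:E) t)%E); last first.
    by rewrite integral_cst// [X in (_ * X)%E]probability_setT mule1.
  apply: ge0_le_integral => //.
  - by move=> t _; exact: integral_ge0.
  - apply: (measurableT_comp (measurable_fun_fubini_tonelli_F (m2 := image_measure P mfW)
      (fun v : @pspace R J * @pspace R I => h v.1 v.2) mh (fun v => h0 v.1 v.2)) mfZ).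
  - move=> t _; rewrite ge0_integral_image//; last first.
      exact: (measurableT_comp mh (measurable_pair1 (fZ t))).
    by rewrite (ind (fun=> fZ t))//; exact: tail.
split; first by rewrite EE; exact: measurableC.
by rewrite EE probability_setC// EFinB leeB.
Qed.
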